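(* Let $\omega$ be a nonempty open subset of $\Omega=(0,L)$, $\vartheta\in\{1,2,3,4\}$, $T>0$ and $A\ge0$. There exists $C_2>0$ such that for every function $h\mapsto\phi(h)>0$ with $$\liminf_{h\to0}\frac{\phi(h)}{e^{-C_2/h^{1/\vartheta}}}>0$$ there exist $h^*>0$ and $C>0$, depending only on $\phi,T,\omega,A,\vartheta$ (and $L$), such that: for all $0<h\le h^*$, all $\Delta t=T/M$ with $\Delta t\le T^{-2}h^{4/\vartheta}$, every potential $a$ with $\|a\|_\infty\le A$ and every $g\in\mathbb R^N$, there exists a control $v=(v^{n+1/2})_{n=0}^{M-1}$, $v^{n+1/2}\in\mathbb R^N$, with $$\Big(\sum_{n=0}^{M-1}\Delta t\,|v^{n+1/2}|^2_{L^2(\omega)}\Big)^{1/2}\le C|g|_{L^2(\Omega)}$$ such that the solution of $$\frac{y^{n+1}-y^n}{\Delta t}-\Delta_hy^{n+1}+a^{n+1}y^{n+1}=\mathbf 1_\omega v^{n+1/2},\quad y^{n+1}_0=y^{n+1}_{N+1}=0\quad(n=0,\dots,M-1),\qquad y^0=g,$$ satisfies $|y^M|_{L^2(\Omega)}\le C\sqrt{\phi(h)}\,|g|_{L^2(\Omega)}$.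
   Context: Grid: $\Omega=(0,L)$, $N,M\ge1$ integers, $h=L/(N+1)$, $\Delta t=T/M$, $x_i=ih$. Primal space functions are vectors $u\in\mathbb R^N$ with boundary values $u_0=u_{N+1}=0$; $(\Delta_hu)_i=(u_{i+1}-2u_i+u_{i-1})/h^2$; $|u|^2_{L^2(\Omega)}=\sum_{i=1}^Nh|u_i|^2$, $|u|^2_{L^2(\omega)}=\sum_{i:x_i\in\omega}h|u_i|^2$. $\mathbf 1_\omega$ is the diagonal $N\times N$ matrix with entry $1$ if $x_i\in\omega$ and $0$ otherwise. The potential is $a=(a^n)_{n=1}^M$, $a^n\in\mathbb R^N$, acting componentwise, $\|a\|_\infty=\max_{n,i}|a_i^n|$. *)

(* Defs.v *)
From HB Require Import structures.
From mathcomp Require Import all_boot all_order all_algebra.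
From mathcomp Require Import all_classical all_reals all_analysis.
Set Implicit Arguments. Unset Strict Implicit. Unset Printing Implicit Defensive.
Import Order.TTheory GRing.Theory Num.Theory.
Local Open Scope classical_set_scope.
Local Open Scope ring_scope.

(* Grid functions are represented as u : nat -> R; only the interior
   indices 1..N are meaningful (x_i = i h). Boundary values u_0, u_{N+1}
   are imposed explicitly where the paper imposes them. *)

Section Grid.
Variable R : realType.

Definition mesh (L : R) (N : nat) : R := L / (N.+1)%:R.

Definition lap_h (h : R) (u : nat -> R) (i : nat) : R :=
  (u i.+1 - 2 * u i + u i.-1) / h ^+ 2.

Definition L2sq (N : nat) (h : R) (u : nat -> R) : R :=
  \sum_(1 <= i < N.+1) h * u i ^+ 2.

Definition L2sq_om (om : set R) (N : nat) (h : R) (u : nat -> R) : R :=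
  \sum_(1 <= i < N.+1 | (i%:R * h) \in om) h * u i ^+ 2.

Definition L2 (N : nat) (h : R) (u : nat -> R) : R := Num.sqrt (L2sq N h u).

Definition ind_om (om : set R) (h : R) (u : nat -> R) (i : nat) : R :=
  if (i%:R * h) \in om then u i else 0.

(* y : nat -> nat -> R, y n = y^n; v n = v^{n+1/2}; a n = a^n.
   The implicit scheme with initial datum g. *)
Definition scheme (om : set R) (N M : nat) (h dt : R)
    (a v y : nat -> nat -> R) (g : nat -> R) : Prop :=
  (forall i, (1 <= i <= N)%N -> y 0%N i = g i) /\
  (forall n, (n < M)%N ->
     y n.+1 0%N = 0 /\ y n.+1 N.+1 = 0 /\
     forall i, (1 <= i <= N)%N ->
       (y n.+1 i - y n i) / dt - lap_h h (y n.+1) i + a n.+1 i * y n.+1 i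
       = ind_om om h (v n) i).

End Grid.

(* Main.v *)
(** The penalized Hilbert uniqueness method reduces the theorem to a relaxed
    observability inequality for the adjoint scheme, run backwards as [z]:
    [|z^M|^2 <= C (sum dt |z^n|^2_om + e^(-1/(4y)) |z^0|^2)] with [y = h^(1/theta)].
    It follows from a discrete Carleman estimate with weight [e^(k_n beta(x))],
    where [beta] is a parabola with vertex outside the domain, so that
    the commutator of the symmetric and antisymmetric parts of the conjugated
    Laplacian is an exact sum of squares, and [k_n = r_n^-2] with [r_n] equal to
    a small multiple of the distance of [t_n] to [{0, T}] plus [y^(1/2)]. Since
    [k_n <= 1/y], [k_n h <= 1] and [k_n^3 dt] is small, the errors of the space
    and time discretizations are absorbed; as [k_0 = k_M = 1/y], the weight at
    the ends is exponentially small in [1/y]. A monotone weight sees the part of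
    the domain on the left of an observation window; a cutoff, a Caccioppoli
    inequality and the reflection [x -> L - x] give the rest. *)

Require Import Defs.
From HB Require Import structures.
From mathcomp Require Import all_boot all_order all_algebra.
From mathcomp Require Import all_classical all_reals all_analysis.
From mathcomp Require Import ring lra zify.
Set Implicit Arguments.
Unset Strict Implicit.
Unset Printing Implicit Defensive.
Import Order.TTheory GRing.Theory Num.Theory.
Import numFieldNormedType.Exports.
Local Open Scope classical_set_scope.
Local Open Scope ring_scope.

(** * Quadratic forms of the conjugated discrete Laplacian *)

Section CarlemanStep.
Variable R : realFieldType.
Implicit Types (u v w z C s G : nat -> R) (N : nat).

(** Every error has to be dominated by the term [k^3 |w|^2] that the commutator yields. The time
    derivative of [k = r^-2] is of size [eps k^(3/2)], and its square [eps^2 k^3] has exactly this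
    order: an exponent closer to 0 would give more than [k^3], and the slope [eps] of [r] supplies
    the smallness. The implicit step adds the form of [w^(n+1) - w^n], which is not quite
    nonnegative because hyperbolic cosines exceed 1; the defect, of relative size [k^2 dt], is paid
    by a small fraction of the squared time difference quotient. On a grid the weight cannot blow up
    at the ends of the time interval, as [k h] must stay bounded, so end terms survive, divided by
    [h^2]. Here the range of [theta] enters: [theta >= 1] gives [h <= y], hence [k h <= 1], and
    [theta <= 4] gives [y^4 <= h], so that [h^-2] is only a power of [1/y], absorbed by half of the
    exponent [1/(2y)]. The other half is the [1/4] of the theorem. *)

Lemma sum_telescope N G : \sum_(i < N) (G i.+1 - G i) = G N - G 0%N.
Proof. by rewrite -(big_mkord xpredT (fun i => G i.+1 - G i)) telescope_sumr. Qed.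

Lemma sum_shift_up N (f : nat -> R) : f 0%N = 0 -> (forall i, 0 <= f i) ->
  \sum_(i < N) f i <= \sum_(i < N) f i.+1.
Proof.
move=> f0 fge; rewrite -subr_ge0 -sumrB (sum_telescope N f) f0 subr0.
exact: fge.
Qed.

Lemma sum_shift_down N (f : nat -> R) : f N.+1 = 0 -> (forall i, 0 <= f i) ->
  \sum_(i < N) f i.+2 <= \sum_(i < N) f i.+1.
Proof.
move=> fN fge; rewrite -subr_ge0 -sumrB.
have -> : \sum_(i < N) (f i.+1 - f i.+2) = - \sum_(i < N) (f i.+2 - f i.+1).
  by rewrite -sumrN; apply: eq_bigr => i _; rewrite opprB.
by rewrite (sum_telescope N (fun i => f i.+1)) fN sub0r opprK.
Qed.

(* In the conjugated operator [e^(k beta) (h^2 Delta_h) e^(-k beta)] the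
   off-diagonal coefficients are [C - s] and [C + s]; [symm] and [skew] are its
   symmetric and antisymmetric parts at the node [i.+1]. *)
Definition symm C w i := C i.+1 * w i.+2 + C i * w i - 2 * w i.+1.
Definition skew s w i := s i * w i - s i.+1 * w i.+2.

(** For [w] vanishing at [0] and [N.+1] this is the sum of [- symm C w i * w i.+1]: an index shift
    merges the two off-diagonal products. *)
Definition symm_form N C w : R :=
  \sum_(i < N) (2 * w i.+1 ^+ 2 - 2 * C i.+1 * w i.+1 * w i.+2).

(** Polarization of the form of a symmetric operator. With [w] and [v] at consecutive time levels,
    the first two forms telescope in time up to the change of [C], and the third is the dissipation
    of the implicit scheme. *)
Lemma symm_form_polar N C w v :
  w 0%N = 0 -> v 0%N = 0 -> w N.+1 = 0 -> v N.+1 = 0 ->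
  \sum_(i < N) (- 2 * symm C w i * (w i.+1 - v i.+1)) =
  symm_form N C w - symm_form N C v + symm_form N C (fun i => w i - v i).
Proof.
move=> w0 v0 wN vN; rewrite /symm_form -!sumrB -!big_split /=.
pose G i := 2 * C i * w i.+1 * w i - C i * w i * v i.+1 * 2 .
rewrite (eq_bigr (fun i : 'I_N =>
   (2 * w i.+1 ^+ 2 - 2 * C i.+1 * w i.+1 * w i.+2 -
    (2 * v i.+1 ^+ 2 - 2 * C i.+1 * v i.+1 * v i.+2) +
    (2 * (w i.+1 - v i.+1) ^+ 2 -
      2 * C i.+1 * (w i.+1 - v i.+1) * (w i.+2 - v i.+2))) +
   (G i.+1 - G i))); last first.
  by move=> i _; rewrite /G /symm; ring.
by rewrite big_split /= sum_telescope /G w0 wN vN !mulr0 !mul0r !subr0 addr0.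
Qed.

(** Hyperbolic cosines exceed 1, so the form may be negative; [2 a b <= a^2 + b^2] on the
    off-diagonal products shows that only the excess [c] is lost. *)
Lemma symm_form_ge N C w c : (forall i, (i < N)%N -> 0 <= C i.+1 <= 1 + c) -> 0 <= c ->
  w N.+1 = 0 ->
  - (2 * c) * \sum_(i < N) w i.+1 ^+ 2 <= symm_form N C w.
Proof.
move=> HC c0 wN.
have Hs := sum_shift_down (f := fun i => w i ^+ 2) (N := N).
rewrite /= wN expr0n in Hs.
have {}Hs := Hs (erefl _) (fun i => sqr_ge0 (w i)).
apply: (@le_trans _ _ (\sum_(i < N) ((1 - c) * w i.+1 ^+ 2 - (1 + c) * w i.+2 ^+ 2))).
  rewrite sumrB -!mulr_sumr.
  have c1 : 0 <= 1 + c by lra.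
  have := ler_wpM2l c1 Hs; lra.
apply: ler_sum => i _.
have /andP[H1 H2] := HC i (ltn_ord i).
have H3 : 2 * C i.+1 * w i.+1 * w i.+2 <= C i.+1 * (w i.+1 ^+ 2 + w i.+2 ^+ 2).
  rewrite -subr_ge0.
  have -> : C i.+1 * (w i.+1 ^+ 2 + w i.+2 ^+ 2) - 2 * C i.+1 * w i.+1 * w i.+2
    = C i.+1 * (w i.+1 - w i.+2) ^+ 2 by ring.
  by rewrite mulr_ge0 ?sqr_ge0.
have H4 : C i.+1 * (w i.+1 ^+ 2 + w i.+2 ^+ 2) <= (1 + c) * (w i.+1 ^+ 2 + w i.+2 ^+ 2).
  by rewrite ler_wpM2r ?addr_ge0 ?sqr_ge0.
lra.
Qed.

Lemma norm_mul_le_sqr (a b : R) : 2 * `|a * b| <= a ^+ 2 + b ^+ 2.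
Proof.
rewrite normrM -(real_normK (num_real a)) -(real_normK (num_real b)).
have := sqr_ge0 (`|a| - `|b|); rewrite sqrrB => H.
rewrite -subr_ge0; apply: (le_trans H); rewrite le_eqVlt; apply/orP; left; apply/eqP; ring.
Qed.

(** Needed because the coefficients change with the weight parameter between time levels; [C' = 0]
    also yields the plain upper bound. *)
Lemma form_diff_le N C C' w c :
  (forall i, (i < N)%N -> `|C i.+1 - C' i.+1| <= c) -> 0 <= c -> w N.+1 = 0 ->
  symm_form N C w - symm_form N C' w <= 2 * c * \sum_(i < N) w i.+1 ^+ 2.
Proof.
move=> HC c0 wN.
have Hs := sum_shift_down (f := fun i => w i ^+ 2) (N := N).
rewrite /= wN expr0n in Hs.
have {}Hs := Hs (erefl _) (fun i => sqr_ge0 (w i)).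
rewrite /symm_form -sumrB.
apply: (@le_trans _ _ (\sum_(i < N) (c * w i.+1 ^+ 2 + c * w i.+2 ^+ 2))); last first.
  rewrite big_split /= -!mulr_sumr.
  have := ler_wpM2l c0 Hs; lra.
apply: ler_sum => i _.
have H1 := HC i (ltn_ord i).
have H2 : - (2 * ((C i.+1 - C' i.+1) * (w i.+1 * w i.+2))) <=
    c * (2 * `|w i.+1 * w i.+2|).
  apply: (le_trans (ler_norm _)); rewrite normrN normrM normrM.
  by rewrite ger0_norm // mulrCA ler_wpM2r // mulr_ge0.
have H3 := ler_wpM2l c0 (norm_mul_le_sqr (w i.+1) (w i.+2)).
lra.
Qed.

Lemma symm_form_le N C w c : (forall i, (i < N)%N -> 0 <= C i.+1 <= c) -> 0 <= c ->
  w N.+1 = 0 ->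
  symm_form N C w <= (2 + 2 * c) * \sum_(i < N) w i.+1 ^+ 2.
Proof.
move=> HC c0 wN.
have := @form_diff_le N C (fun=> 0) w c _ c0 wN.
have -> : symm_form N (fun=> 0) w = 2 * \sum_(i < N) w i.+1 ^+ 2.
  rewrite /symm_form mulr_sumr; apply: eq_bigr => i _; ring.
move=> H; rewrite mulrDl -lerBlDl; apply: H => i iN; rewrite subr0.
by have /andP[H1 H2] := HC i iN; rewrite ger0_norm.
Qed.

(* The cross term of the Carleman estimate is exact: all mixed products cancel
   because [sinh] satisfies its addition formula. *)
Lemma skew_symm_commutator N C s w (g : R) (K : nat -> R) :
  w 0%N = 0 -> w N = 0 -> w N.+1 = 0 ->
  (forall i, (i < N)%N -> s i * C i.+1 - s i.+1 * C i = - g) ->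
  (forall i, (i < N)%N -> s i.+1 * C i.+1 - s i * C i = g * K i) ->
  0 <= s 0%N * C 0%N -> 0 <= g ->
  \sum_(i < N) (g * (w i.+2 - w i) ^+ 2 + 2 * g * (K i - 1) * w i.+1 ^+ 2)
  <= \sum_(i < N) (2 * skew s w i * symm C w i).
Proof.
move=> w0 wN wN1 H1 H2 H3 g0.
pose G i := 4 * s i * w i * w i.+1 - 2 * s i * C i * (w i.+1 ^+ 2 + w i ^+ 2)
  - g * (w i.+1 ^+ 2 - w i ^+ 2).
rewrite -subr_ge0 -sumrB.
rewrite (eq_bigr (fun i : 'I_N => G i.+1 - G i)); last first.
  move=> i _.
  have E1 : g = - (s i * C i.+1 - s i.+1 * C i) by rewrite H1 // opprK.
  have E2 := H2 i (ltn_ord i).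
  rewrite /G /skew /symm.
  have -> : 2 * g * (K i - 1) * w i.+1 ^+ 2 =
    2 * (g * K i) * w i.+1 ^+ 2 - 2 * g * w i.+1 ^+ 2 by ring.
  by rewrite -E2 E1; ring.
rewrite sum_telescope /G w0 wN wN1.
have := mulr_ge0 H3 (sqr_ge0 (w 1%N)); have := mulr_ge0 g0 (sqr_ge0 (w 1%N)).
lra.
Qed.

End CarlemanStep.

(** * Carleman estimate for one implicit step with abstract coefficients *)

Section CarlemanInequality.
Variable R : realFieldType.
Implicit Types (u v w z C s G : nat -> R) (N : nat).

Lemma sqr_add_le2 (a b : R) : (a + b) ^+ 2 <= 2 * a ^+ 2 + 2 * b ^+ 2.
Proof. have := sqr_ge0 (a - b); rewrite !expr2; lra. Qed.

Lemma sqr_norm_le (a b : R) : `|a| <= b -> a ^+ 2 <= b ^+ 2.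
Proof.
move=> H; rewrite -(real_normK (num_real a)).
by rewrite lerXn2r ?nnegrE // (le_trans (normr_ge0 a)).
Qed.

(** The square of [p - (A + B)] is expanded, with [p] the time quotient and [A], [B] the scaled
    symmetric and antisymmetric parts: the product of [A] and [p] gives the forms, that of [A] and
    [B] the commutator. Half of the [k^3] term of the commutator is kept; the other half and its
    gradient term pay for the errors. The condition [w N = 0] removes the right boundary term of the
    commutator, which can have the wrong sign. *)
Lemma carleman_step N C s w v (g : R) (K : nat -> R) (h tau k c l : R) :
  0 < h -> 0 < tau -> 0 < c -> 1 <= k -> 0 < l ->
  w 0%N = 0 -> w N = 0 -> w N.+1 = 0 -> v 0%N = 0 -> v N.+1 = 0 ->
  (forall i, (i < N)%N -> s i * C i.+1 - s i.+1 * C i = - g) ->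
  (forall i, (i < N)%N -> s i.+1 * C i.+1 - s i * C i = g * K i) ->
  (forall i, (i <= N)%N -> 0 <= C i <= 1 + c * (k * h) ^+ 2) ->
  (forall i, (i <= N)%N -> 0 <= s i <= c * (k * h)) ->
  (forall i, (i < N)%N -> `|s i.+1 - s i| <= c * (k * h ^+ 2)) ->
  k * h ^+ 2 <= g -> (forall i, (i < N)%N -> 2 * l * (k * h) ^+ 2 <= K i - 1) ->
  4 * c * k ^+ 2 * tau <= 1 -> 8 * c ^+ 3 * k ^+ 3 * tau <= 1 ->
  8 * c ^+ 3 * k * tau <= 2 * l ->
  (symm_form N C w - symm_form N C v) / (h ^+ 2 * tau)
   + 2 * l * k ^+ 3 * \sum_(i < N) w i.+1 ^+ 2 <=
  \sum_(i < N) ((w i.+1 - v i.+1) / tau - (symm C w i + skew s w i) / h ^+ 2) ^+ 2.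
Proof.
move=> h0 t0 c0 k1 l0 w0 wN wN1 v0 vN1 H1 H2 HC Hs Hds Hg HK T1 T2 T3.
have k0 : 0 < k by lra.
have hn : h != 0 by rewrite gt_eqF.
have tn : tau != 0 by rewrite gt_eqF.
have g0 : 0 <= g by apply: le_trans Hg; rewrite mulr_ge0 ?exprn_ge0 // ltW.
have kh0 : 0 <= k * h by rewrite mulr_ge0 ?ltW.
(* The form of [w - v] can be as low as [- a / 2] times the sum of the squared time quotients. So
   [a / 2] of that square is kept in [pt], at the price of [a] times the squared antisymmetric
   part. *)
set a := 4 * c * k ^+ 2 * tau.
have a0 : 0 <= a by rewrite !mulr_ge0 ?exprn_ge0 ?ltW.
have sq i : (i < N)%N -> skew s w i ^+ 2 <=
   2 * c ^+ 2 * (k * h) ^+ 2 * (w i.+2 - w i) ^+ 2 +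
   2 * c ^+ 2 * (k * h ^+ 2) ^+ 2 * w i ^+ 2.
  move=> iN.
  have -> : skew s w i = (- s i.+1 * (w i.+2 - w i)) + (- (s i.+1 - s i) * w i).
    by rewrite /skew; ring.
  apply: (le_trans (sqr_add_le2 _ _)).
  have /andP[S1 S2] := Hs i.+1 iN.
  have S3 : s i.+1 ^+ 2 <= (c * (k * h)) ^+ 2 by apply: sqr_norm_le; rewrite ger0_norm.
  have S4 := sqr_norm_le (Hds i iN).
  have := ler_wpM2r (sqr_ge0 (w i.+2 - w i)) S3.
  have := ler_wpM2r (sqr_ge0 (w i)) S4.
  rewrite !exprMn !sqrrN; lra.
have pt i : (i < N)%N ->
   - 2 * symm C w i * (w i.+1 - v i.+1) / (h ^+ 2 * tau) +
   2 * skew s w i * symm C w i / h ^+ 4 + a / 2 * ((w i.+1 - v i.+1) / tau) ^+ 2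
   - a / h ^+ 4 * (2 * c ^+ 2 * (k * h) ^+ 2 * (w i.+2 - w i) ^+ 2 +
   2 * c ^+ 2 * (k * h ^+ 2) ^+ 2 * w i ^+ 2)
   <= ((w i.+1 - v i.+1) / tau - (symm C w i + skew s w i) / h ^+ 2) ^+ 2.
  move=> iN.
  set p := (w i.+1 - v i.+1) / tau.
  have -> : - 2 * symm C w i * (w i.+1 - v i.+1) / (h ^+ 2 * tau) =
     - 2 * symm C w i / h ^+ 2 * p by rewrite /p; field; rewrite tn.
  set A := symm C w i; set B := skew s w i.
  have E1 : (p - (A + B) / h ^+ 2) ^+ 2 = (p - B / h ^+ 2) ^+ 2 + (A / h ^+ 2) ^+ 2
     + (- 2 * A / h ^+ 2 * p + 2 * B * A / h ^+ 4).
    by field.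
  rewrite E1.
  have E2 : p ^+ 2 <= 2 * (p - B / h ^+ 2) ^+ 2 + 2 * (B / h ^+ 2) ^+ 2.
    by rewrite -{1}[p](subrK (B / h ^+ 2)); exact: sqr_add_le2.
  have E3 : a * (p - B / h ^+ 2) ^+ 2 <= (p - B / h ^+ 2) ^+ 2.
    by rewrite ler_piMl ?sqr_ge0.
  have E4 : a / h ^+ 4 * B ^+ 2 <= a / h ^+ 4 * (2 * c ^+ 2 * (k * h) ^+ 2 * (w i.+2 - w i) ^+ 2 +
   2 * c ^+ 2 * (k * h ^+ 2) ^+ 2 * w i ^+ 2).
    by rewrite ler_wpM2l ?sq // divr_ge0 ?exprn_ge0 // ltW.
  have E5 : (B / h ^+ 2) ^+ 2 = B ^+ 2 / h ^+ 4 by field.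
  have E6 := ler_wpM2l a0 E2.
  rewrite E5 in E6.
  have E7 := sqr_ge0 (A / h ^+ 2).
  have E8 : a / h ^+ 4 * B ^+ 2 = a * (B ^+ 2 / h ^+ 4) by ring.
  lra.
apply: le_trans (ler_sum _ (fun (i : 'I_N) _ => pt i (ltn_ord i))).
have S1 : \sum_(i < N) (- 2 * symm C w i * (w i.+1 - v i.+1) / (h ^+ 2 * tau)) =
  (symm_form N C w - symm_form N C v) / (h ^+ 2 * tau) +
  symm_form N C (fun i => w i - v i) / (h ^+ 2 * tau).
  by rewrite -mulr_suml symm_form_polar // mulrDl.
have S2 : - (a / 2) * \sum_(i < N) ((w i.+1 - v i.+1) / tau) ^+ 2 <=
   symm_form N C (fun i => w i - v i) / (h ^+ 2 * tau).
  rewrite ler_pdivlMr ?mulr_gt0 ?exprn_gt0 //.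
  have := @symm_form_ge _ N C (fun i => w i - v i) (c * (k * h) ^+ 2).
  rewrite /= wN1 vN1 subrr => Q.
  apply: le_trans (Q _ _ (erefl _)).
  - rewrite le_eqVlt; apply/orP; left; apply/eqP.
    rewrite -mulrA mulrAC mulr_suml !mulr_sumr; apply: eq_bigr => i _.
    by rewrite /a; field.
  - by move=> i iN; apply: HC.
  - by rewrite mulr_ge0 ?sqr_ge0 // ltW.
have S3 : \sum_(i < N) (k / h ^+ 2 * (w i.+2 - w i) ^+ 2 + 4 * l * k ^+ 3 * w i.+1 ^+ 2)
   <= \sum_(i < N) (2 * skew s w i * symm C w i / h ^+ 4).
  rewrite -[leRHS]mulr_suml ler_pdivlMr ?exprn_gt0 //.
  have := @skew_symm_commutator _ N C s w g K w0 wN wN1 H1 H2 _ g0.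
  move=> Q; apply: le_trans (Q _); last first.
    have /andP[? ?] := HC 0%N isT; have /andP[? ?] := Hs 0%N isT.
    by rewrite mulr_ge0.
  rewrite mulr_suml; apply: ler_sum => i _.
  have U1 := ler_wpM2r (sqr_ge0 (w i.+2 - w i)) Hg.
  have U2 : (k * h ^+ 2) * (2 * l * (k * h) ^+ 2) <= g * (K i - 1).
    apply: ler_pM => //; last exact: HK.
      by rewrite mulr_ge0 ?exprn_ge0 // ltW.
    by rewrite !mulr_ge0 ?exprn_ge0 // ltW.
  have U3 := ler_wpM2r (sqr_ge0 (w i.+1)) U2.
  have -> : (k / h ^+ 2 * (w i.+2 - w i) ^+ 2 + 4 * l * k ^+ 3 * w i.+1 ^+ 2) * h ^+ 4
    = (k * h ^+ 2) * (w i.+2 - w i) ^+ 2 +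
      2 * ((k * h ^+ 2) * (2 * l * (k * h) ^+ 2) * w i.+1 ^+ 2) by field.
  lra.
have S4 : \sum_(i < N) w i ^+ 2 <= \sum_(i < N) w i.+1 ^+ 2.
  by apply: (@sum_shift_up _ N (fun i => w i ^+ 2)) => [|i]; rewrite ?w0 ?expr0n ?sqr_ge0.
have S5 : \sum_(i < N) (a / h ^+ 4 * (2 * c ^+ 2 * (k * h) ^+ 2 * (w i.+2 - w i) ^+ 2 +
   2 * c ^+ 2 * (k * h ^+ 2) ^+ 2 * w i ^+ 2)) <=
   \sum_(i < N) (k / h ^+ 2 * (w i.+2 - w i) ^+ 2) +
     2 * l * k ^+ 3 * \sum_(i < N) w i.+1 ^+ 2.
  apply: (@le_trans _ _ (\sum_(i < N) (k / h ^+ 2 * (w i.+2 - w i) ^+ 2 + 2 * l * k ^+ 3 * w i ^+ 2))).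
    apply: ler_sum => i _.
    have V1 : 8 * c ^+ 3 * k ^+ 3 * tau * (k / h ^+ 2 * (w i.+2 - w i) ^+ 2) <=
        (k / h ^+ 2 * (w i.+2 - w i) ^+ 2).
      apply: ler_piMl => //; apply: mulr_ge0; last exact: sqr_ge0.
      by apply: divr_ge0; [exact: ltW | exact: sqr_ge0].
    have V2 : 8 * c ^+ 3 * k * tau * (k ^+ 3 * w i ^+ 2) <= 2 * l * (k ^+ 3 * w i ^+ 2).
      by rewrite ler_wpM2r // mulr_ge0 ?sqr_ge0 ?exprn_ge0 // ltW.
    have -> : a / h ^+ 4 * (2 * c ^+ 2 * (k * h) ^+ 2 * (w i.+2 - w i) ^+ 2 +
   2 * c ^+ 2 * (k * h ^+ 2) ^+ 2 * w i ^+ 2) =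
      8 * c ^+ 3 * k ^+ 3 * tau * (k / h ^+ 2 * (w i.+2 - w i) ^+ 2) +
      8 * c ^+ 3 * k * tau * (k ^+ 3 * w i ^+ 2) by rewrite /a; field.
    lra.
  rewrite big_split /= lerD2l -mulr_sumr ler_wpM2l //.
  by rewrite !mulr_ge0 ?exprn_ge0 // ltW.
rewrite sumrB !big_split /= S1 -mulr_sumr.
rewrite big_split /= -[X in _ + X]mulr_sumr in S3.
lra.
Qed.
End CarlemanInequality.

(** * Hyperbolic functions *)

Section Hyperbolic.
Variable R : realType.
Implicit Types x y : R.

Definition sinhR x := (expR x - expR (- x)) / 2.
Definition coshR x := (expR x + expR (- x)) / 2.

Lemma expR_half x : expR x = expR (x / 2) ^+ 2.
Proof. by rewrite expr2 -expRD -splitr. Qed.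

Lemma expR_mulN x : expR x * expR (- x) = 1.
Proof. by rewrite -expRD subrr expR0. Qed.

Lemma sinhRB x y : sinhR x * coshR y - sinhR y * coshR x = sinhR (x - y).
Proof. by rewrite /sinhR /coshR opprB !expRD !expRN; field; rewrite ?gt_eqF ?expR_gt0. Qed.

Lemma sinhRN x : sinhR (- x) = - sinhR x.
Proof. by rewrite /sinhR opprK; field. Qed.

Lemma sinh_cosh_diff x y :
  sinhR x * coshR x - sinhR y * coshR y = sinhR (x - y) * coshR (x + y).
Proof.
rewrite /sinhR /coshR !opprD !expRD !expRN.
by field; rewrite ?gt_eqF ?expR_gt0.
Qed.

Lemma coshR_sub1 x : coshR x - 1 = 2 * sinhR (x / 2) ^+ 2.
Proof.
rewrite /sinhR /coshR (expR_half x) -mulNr (expR_half (- x)).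
rewrite mulNr; have := expR_mulN (x / 2).
set a := expR _; set b := expR _ => E.
have <- : (a ^+ 2 + b ^+ 2) / 2 - a * b = 2 * ((a - b) / 2) ^+ 2 by field.
by rewrite E.
Qed.

Lemma coshR_diff x y :
  coshR x - coshR y = 2 * sinhR ((x + y) / 2) * sinhR ((x - y) / 2).
Proof.
set p := (x + y) / 2; set q := (x - y) / 2.
have -> : x = p + q by rewrite /p /q; field.
have -> : y = p - q by rewrite /p /q; field.
rewrite /coshR /sinhR !opprD !opprK !expRD !expRN.
by field; rewrite ?gt_eqF ?expR_gt0.
Qed.

Lemma sinhR_diff x y :
  sinhR x - sinhR y = 2 * coshR ((x + y) / 2) * sinhR ((x - y) / 2).
Proof.
set p := (x + y) / 2; set q := (x - y) / 2.
have -> : x = p + q by rewrite /p /q; field.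
have -> : y = p - q by rewrite /p /q; field.
rewrite /coshR /sinhR !opprD !opprK !expRD !expRN.
by field; rewrite ?gt_eqF ?expR_gt0.
Qed.

Lemma sinhR_ge x : 0 <= x -> x / 2 <= sinhR x.
Proof.
move=> x0; rewrite /sinhR ler_pM2r ?invr_gt0 //.
have := expR_ge1Dx x; have : expR (- x) <= 1 by rewrite -expR0 ler_expR oppr_le0.
lra.
Qed.

Lemma sinhR_ge0 x : 0 <= x -> 0 <= sinhR x.
Proof. by move=> x0; apply: le_trans (sinhR_ge x0); rewrite divr_ge0. Qed.

Lemma sinhR_le x : 0 <= x -> sinhR x <= x * expR x.
Proof.
move=> x0; rewrite /sinhR.
have -> : expR (- x) = expR x * expR (- (x + x)) by rewrite -expRD; congr expR; lra.
have H := expR_ge1Dx (- (x + x)).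
have := ler_wpM2l (ltW (expR_gt0 x)) H; lra.
Qed.

Lemma norm_sinhR_le x b : `|x| <= b -> `|sinhR x| <= `|x| * expR b.
Proof.
move=> xb.
suff H y : 0 <= y -> y <= b -> `|sinhR y| <= y * expR b.
  have [x0|x0] := leP 0 x; first by rewrite ger0_norm // in xb *; exact: H.
  rewrite ltr0_norm // in xb *.
  by rewrite -normrN -sinhRN; apply: H => //; lra.
move=> y0 yb; rewrite ger0_norm ?sinhR_ge0 //; apply: (le_trans (sinhR_le y0)).
by rewrite ler_wpM2l // ler_expR.
Qed.

Lemma coshR_sub1_ge x : 0 <= x -> x ^+ 2 / 8 <= coshR x - 1.
Proof.
move=> x0; rewrite coshR_sub1.
have x2 : 0 <= x / 2 by rewrite divr_ge0.
have : (x / 2 / 2) ^+ 2 <= sinhR (x / 2) ^+ 2.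
  by rewrite lerXn2r ?nnegrE ?sinhR_ge0 ?divr_ge0 // sinhR_ge.
by rewrite !expr2; lra.
Qed.

Lemma coshR_ge1 x : 1 <= coshR x.
Proof. by rewrite -subr_ge0 coshR_sub1 mulr_ge0 ?sqr_ge0. Qed.

Lemma coshR_ge0 x : 0 <= coshR x.
Proof. exact: le_trans ler01 (coshR_ge1 x). Qed.

Lemma coshR_sub1_le x : 0 <= x -> coshR x - 1 <= x ^+ 2 * expR x.
Proof.
move=> x0; rewrite coshR_sub1.
have x2 : 0 <= x / 2 by rewrite divr_ge0.
have : sinhR (x / 2) ^+ 2 <= (x / 2 * expR (x / 2)) ^+ 2.
  by rewrite lerXn2r ?nnegrE ?sinhR_ge0 ?mulr_ge0 ?expR_ge0 // sinhR_le.
have -> : (x / 2 * expR (x / 2)) ^+ 2 = (x / 2) ^+ 2 * expR x by rewrite exprMn [in RHS]expR_half.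
have := mulr_ge0 (sqr_ge0 x) (expR_ge0 x); rewrite !expr2; lra.
Qed.

Lemma coshR_le x : 0 <= x -> coshR x <= expR x.
Proof.
move=> x0; rewrite /coshR.
have : expR (- x) <= expR x by rewrite ler_expR; lra.
lra.
Qed.

End Hyperbolic.

(** * The quadratic weight and its increments *)

Section Weight.
Variable R : realType.
Implicit Types (L h k tau : R).

(* A parabola centred at [-L]: increasing on [0, L], with values at most [-1]. *)
Definition wt L h (i : nat) : R := (i%:R * h + L) ^+ 2 - (4 * L ^+ 2 + 1).
Definition dwt L h i := wt L h i.+1 - wt L h i.
Definition wcosh L h k i := coshR (k * dwt L h i).
Definition wsinh L h k i := sinhR (k * dwt L h i).

Lemma wt_conjugate L h k (u : nat -> R) i :
  let w := fun j => expR (k * wt L h j) * u j in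
  symm (wcosh L h k) w i + skew (wsinh L h k) w i =
  expR (k * wt L h i.+1) * (u i.+2 - 2 * u i.+1 + u i).
Proof.
rewrite /= /symm /skew /wcosh /wsinh /coshR /sinhR /dwt.
move: (wt L h i) (wt L h i.+1) (wt L h i.+2) => a b c.
rewrite !(mulrBr k) !opprB !expRD !expRN.
by field; rewrite ?gt_eqF ?expR_gt0.
Qed.

Lemma dwtE L h i : dwt L h i = h * (2 * i%:R * h + h + 2 * L).
Proof. by rewrite /dwt /wt -addn1 natrD; ring. Qed.

Lemma dwt_bounds L h N i : 0 < L -> 0 < h -> N.+1%:R * h = L -> (i <= N)%N ->
  0 <= dwt L h i <= 4 * L * h.
Proof.
move=> L0 h0 E iN.
have : i.+1%:R * h <= L by rewrite -E ler_pM2r // ler_nat.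
have : 0 <= i%:R * h by rewrite mulr_ge0 // ltW.
rewrite dwtE -addn1 natrD mulrDl mul1r => H1 H2.
apply/andP; split; first by rewrite mulr_ge0 ?ltW //; lra.
by rewrite mulrC ler_pM2r //; lra.
Qed.

Lemma wt_bounds L h N i : 0 < L -> 0 < h -> N.+1%:R * h = L -> (i <= N.+1)%N ->
  - (4 * L ^+ 2 + 1) <= wt L h i <= - 1.
Proof.
move=> L0 h0 E iN.
have H1 : i%:R * h <= L by rewrite -E ler_pM2r // ler_nat.
have H2 : 0 <= i%:R * h by rewrite mulr_ge0 // ltW.
rewrite /wt; have := sqr_ge0 (i%:R * h + L).
have : (i%:R * h + L) ^+ 2 <= (2 * L) ^+ 2 by rewrite lerXn2r ?nnegrE; lra.
rewrite exprMn !expr2; lra.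
Qed.

(** One constant for all the bounds below: the first factor dominates the prefactors [(4 L)^2],
    [4 L] and [2], and the exponentials dominate those of [k * dwt <= 4 L] and [k h^2 <= L]. *)
Definition wconst L : R := (16 * L ^+ 2 + 4 * L + 2) * expR (4 * L) * expR L.

Lemma wconst_gt0 L : 0 < L -> 0 < wconst L.
Proof. by move=> L0; rewrite !mulr_gt0 ?expR_gt0 //; have := sqr_ge0 L; lra. Qed.

Lemma kdwt_bounds L h k N i : 0 < L -> 0 < h -> N.+1%:R * h = L -> 0 <= k -> k * h <= 1 ->
  (i <= N)%N ->
  0 <= k * dwt L h i /\ k * dwt L h i <= 4 * L * (k * h) /\ k * dwt L h i <= 4 * L.
Proof.
move=> L0 h0 hN k0 kh iN; have /andP[d0 d1] := dwt_bounds L0 h0 hN iN.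
have H : k * dwt L h i <= 4 * L * (k * h) by rewrite mulrCA ler_wpM2l.
split; first by rewrite mulr_ge0.
split=> //; apply: (le_trans H).
by rewrite ler_piMr //; lra.
Qed.

Lemma expR_const_ge L a x y : 0 <= a -> a <= 16 * L ^+ 2 + 4 * L + 2 ->
  x <= 4 * L -> y <= L ->
  a * expR x * expR y <= wconst L.
Proof.
move=> a0 aL xL yL; rewrite /wconst.
apply: ler_pM; rewrite ?mulr_ge0 ?expR_ge0 ?ler_expR //.
by apply: ler_pM; rewrite ?expR_ge0 ?ler_expR.
Qed.

Lemma wcosh_bounds L h k N i : 0 < L -> 0 < h -> N.+1%:R * h = L -> 0 <= k -> k * h <= 1 ->
  (i <= N)%N ->
  0 <= wcosh L h k i <= 1 + wconst L * (k * h) ^+ 2.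
Proof.
move=> L0 h0 hN k0 kh iN; have [A1 [A2 A3]] := kdwt_bounds L0 h0 hN k0 kh iN.
rewrite coshR_ge0 /= -lerBlDl.
apply: (le_trans (coshR_sub1_le A1)).
have B1 : (k * dwt L h i) ^+ 2 <= (4 * L * (k * h)) ^+ 2.
  by rewrite lerXn2r ?nnegrE // (le_trans A1).
have B2 : (4 * L) ^+ 2 * expR (k * dwt L h i) * expR 0 <= wconst L.
  by apply: expR_const_ge; rewrite ?sqr_ge0 // ?(ltW L0) //; rewrite !expr2; lra.
rewrite expR0 mulr1 in B2.
have B3 := ler_wpM2r (sqr_ge0 (k * h)) B2.
apply: (le_trans _ B3).
rewrite [leRHS]mulrAC ler_wpM2r ?expR_ge0 //.
by rewrite -exprMn.
Qed.

Lemma wsinh_bounds L h k N i : 0 < L -> 0 < h -> N.+1%:R * h = L -> 0 <= k -> k * h <= 1 ->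
  (i <= N)%N ->
  0 <= wsinh L h k i <= wconst L * (k * h).
Proof.
move=> L0 h0 hN k0 kh iN; have [A1 [A2 A3]] := kdwt_bounds L0 h0 hN k0 kh iN.
rewrite sinhR_ge0 //=.
apply: (le_trans (sinhR_le A1)).
have B2 : (4 * L) * expR (k * dwt L h i) * expR 0 <= wconst L.
  by apply: expR_const_ge; rewrite ?(ltW L0) //; have := sqr_ge0 L; lra.
rewrite expR0 mulr1 in B2.
have kh0 : 0 <= k * h by rewrite mulr_ge0 // ltW.
apply: (le_trans _ (ler_wpM2r kh0 B2)).
by rewrite [leRHS]mulrAC ler_wpM2r ?expR_ge0.
Qed.

(** The reason for a parabola: with increments in arithmetic progression, the coefficient
    [g = sinhR (2 k h^2)] of the commutator is the same at all nodes. *)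
Lemma dwt_step L h i : dwt L h i.+1 - dwt L h i = 2 * h ^+ 2.
Proof. by rewrite !dwtE -addn1 natrD; ring. Qed.

Lemma wsinh_step L h k N i : 0 < L -> 0 < h -> N.+1%:R * h = L -> 0 <= k -> k * h <= 1 ->
  (i < N)%N ->
  `|wsinh L h k i.+1 - wsinh L h k i| <= wconst L * (k * h ^+ 2).
Proof.
move=> L0 h0 hN k0 kh iN; have [A1 [A2 A3]] := kdwt_bounds L0 h0 hN k0 kh iN.
have [B1 [B2 B3]] := kdwt_bounds L0 h0 hN k0 kh (ltnW iN).
rewrite /wsinh sinhR_diff -mulrBr dwt_step.
have -> : k * (2 * h ^+ 2) / 2 = k * h ^+ 2 by field.
have hL : h <= L by rewrite -hN ler_peMl ?ler1n // ltW.
have K0 : 0 <= k * h ^+ 2 by rewrite mulr_ge0 // sqr_ge0.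
have K1 : k * h ^+ 2 <= L.
  rewrite expr2 mulrA; apply: le_trans hL.
  by rewrite ler_piMl // ltW.
set m := (_ + _) / 2.
have m0 : 0 <= m by rewrite divr_ge0 ?addr_ge0.
have m1 : m <= 4 * L by rewrite /m; lra.
rewrite ger0_norm; last first.
  by apply: mulr_ge0; [exact: mulr_ge0 (ler0n _ 2) (coshR_ge0 _) | exact: sinhR_ge0].
have C1 : 2 * expR m * expR (k * h ^+ 2) <= wconst L.
  by apply: expR_const_ge => //; have := sqr_ge0 L; lra.
apply: (le_trans _ (ler_wpM2r K0 C1)).
rewrite -[leRHS]mulrA.
apply: ler_pM; rewrite ?sinhR_ge0 //.
- by rewrite mulr_ge0 // coshR_ge0.
- by rewrite ler_wpM2l // coshR_le.
- by rewrite [leRHS]mulrC; apply: sinhR_le.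
Qed.

Lemma wcosh_diff L h k k' N i : 0 < L -> 0 < h -> N.+1%:R * h = L ->
  0 <= k -> 0 <= k' -> k * h <= 1 -> k' * h <= 1 -> (i <= N)%N ->
  `|wcosh L h k i - wcosh L h k' i| <=
     wconst L ^+ 2 * ((k + k') * `|k - k'| * h ^+ 2).
Proof.
move=> L0 h0 hN k0 k'0 kh k'h iN.
have [A1 [A2 A3]] := kdwt_bounds L0 h0 hN k0 kh iN.
have [B1 [B2 B3]] := kdwt_bounds L0 h0 hN k'0 k'h iN.
have /andP[d0 d1] := dwt_bounds L0 h0 hN iN.
rewrite /wcosh coshR_diff.
set p := (_ + _) / 2; set q := (_ - _) / 2.
have p0 : 0 <= p by rewrite divr_ge0 ?addr_ge0.
have H1 : `|p| <= 4 * L by rewrite ger0_norm // /p; lra.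
have H2 : `|q| <= 4 * L by rewrite ler_norml /q; lra.
have P : p = (k + k') * (dwt L h i / 2) by rewrite /p; field.
have Q : `|q| = `|k - k'| * (dwt L h i / 2).
  have -> : q = (k - k') * (dwt L h i / 2) by rewrite /q; field.
  by rewrite normrM [X in _ * X]ger0_norm // divr_ge0.
rewrite normrM normrM (ger0_norm (ler0n _ 2)).
have E1 := norm_sinhR_le H1; have E2 := norm_sinhR_le H2.
rewrite (ger0_norm p0) in E1.
apply: (@le_trans _ _ (2 * (p * expR (4 * L)) * (`|q| * expR (4 * L)))).
  by apply: ler_pM; rewrite ?mulr_ge0 // ler_wpM2l.
have D : (dwt L h i / 2) ^+ 2 <= (2 * L * h) ^+ 2.
  have Lh : 0 <= L * h by rewrite mulr_ge0 ?ltW.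
  by rewrite lerXn2r ?nnegrE; lra.
have kk : 0 <= (k + k') * `|k - k'| by rewrite mulr_ge0 // addr_ge0.
have W : 4 * L * expR (4 * L) * expR 0 <= wconst L.
  by apply: expR_const_ge; rewrite ?(ltW L0) //; have := sqr_ge0 L; lra.
rewrite expR0 mulr1 in W.
have W2 : (4 * L * expR (4 * L)) ^+ 2 <= wconst L ^+ 2.
  rewrite lerXn2r ?nnegrE //; last by rewrite ltW // wconst_gt0.
  by rewrite !mulr_ge0 ?expR_ge0 // ltW.
have kkh : 0 <= (k + k') * `|k - k'| * h ^+ 2 by rewrite mulr_ge0 ?sqr_ge0.
apply: (le_trans _ (ler_wpM2r kkh W2)).
have kke : 0 <= 2 * ((k + k') * `|k - k'|) * expR (4 * L) ^+ 2.
  by rewrite mulr_ge0 ?sqr_ge0 // mulr_ge0.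
have := ler_wpM2l kke D.
rewrite Q P => D'.
have Z : 0 <= ((k + k') * `|k - k'|) * (2 * L * h * expR (4 * L)) ^+ 2.
  by rewrite mulr_ge0 ?sqr_ge0.
apply: (@le_trans _ _ (2 * ((k + k') * `|k - k'|) * expR (4 * L) ^+ 2 * (dwt L h i / 2) ^+ 2)).
  by rewrite le_eqVlt; apply/orP; left; apply/eqP; ring.
apply: (le_trans D'); rewrite -subr_ge0.
have -> : (4 * L * expR (4 * L)) ^+ 2 * ((k + k') * `|k - k'| * h ^+ 2) -
  2 * ((k + k') * `|k - k'|) * expR (4 * L) ^+ 2 * (2 * L * h) ^+ 2 =
  2 * (((k + k') * `|k - k'|) * (2 * L * h * expR (4 * L)) ^+ 2) by ring.
by rewrite mulr_ge0.
Qed.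

Lemma carleman_wt L : 0 < L -> exists eta : R, 0 < eta /\
  forall N (h tau k : R) (u v w : nat -> R), 0 < h -> N.+1%:R * h = L -> 0 < tau ->
  1 <= k -> k * h <= 1 -> k ^+ 3 * tau <= eta ->
  u 0%N = 0 -> u N = 0 -> u N.+1 = 0 -> v 0%N = 0 -> v N.+1 = 0 ->
  (forall i, w i = expR (k * wt L h i) * u i) ->
  (symm_form N (wcosh L h k) w - symm_form N (wcosh L h k) v) / (h ^+ 2 * tau)
   + 2 * L ^+ 2 * k ^+ 3 * \sum_(i < N) w i.+1 ^+ 2 <=
  \sum_(i < N) ((w i.+1 - v i.+1) / tau -
     expR (k * wt L h i.+1) * (u i.+2 - 2 * u i.+1 + u i) / h ^+ 2) ^+ 2.
Proof.
move=> L0; have c0 := wconst_gt0 L0; set c := wconst L in c0.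
have L20 : 0 < 2 * L ^+ 2 by rewrite mulr_gt0 ?exprn_gt0.
(* One summand for each of the three smallness conditions of [carleman_step]; as [k >= 1], all of
   them follow from a bound on [k^3 tau]. *)
pose e := 4 * c + 8 * c ^+ 3 + 8 * c ^+ 3 / (2 * L ^+ 2).
have a1 : 0 < 4 * c by rewrite mulr_gt0.
have a2 : 0 < 8 * c ^+ 3 by rewrite mulr_gt0 ?exprn_gt0.
have a3 : 0 < 8 * c ^+ 3 / (2 * L ^+ 2) by rewrite divr_gt0.
have e0 : 0 < e by rewrite !addr_gt0.
exists e^-1; split; first by rewrite invr_gt0.
move=> N h tau k u v w h0 hN t0 k1 kh kt u0 uN uN1 v0 vN1 Hw.
have -> : w = (fun i => expR (k * wt L h i) * u i) by apply: funext. clear w Hw.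
set w := fun i => _.
have k0 : 0 <= k by lra.
have kte : e * (k ^+ 3 * tau) <= 1 by rewrite mulrC -ler_pdivlMr ?div1r.
have k23 : k ^+ 2 * tau <= k ^+ 3 * tau by rewrite ler_pM2r // [leRHS]exprS ler_peMl ?sqr_ge0.
have k13 : k * tau <= k ^+ 3 * tau.
  by rewrite ler_pM2r // exprS ler_peMr // expr_ge1.
have z0 : 0 <= k ^+ 3 * tau by rewrite mulr_ge0 ?exprn_ge0 // ltW.
have b1 := mulr_ge0 (ltW a1) z0; have b2 := mulr_ge0 (ltW a2) z0.
have b3 := mulr_ge0 (ltW a3) z0; rewrite /e in kte.
have := @carleman_step _ N (wcosh L h k) (wsinh L h k) w v (sinhR (k * (2 * h ^+ 2)))
  (fun i => coshR (k * dwt L h i.+1 + k * dwt L h i)) h tau k c (L ^+ 2).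
have <- : \sum_(i < N) ((w i.+1 - v i.+1) / tau -
    (symm (wcosh L h k) w i + skew (wsinh L h k) w i) / h ^+ 2) ^+ 2 =
  \sum_(i < N) ((w i.+1 - v i.+1) / tau -
     expR (k * wt L h i.+1) * (u i.+2 - 2 * u i.+1 + u i) / h ^+ 2) ^+ 2.
  by apply: eq_bigr => i _; have /= -> := wt_conjugate L h k u i.
have K0 : 0 <= k * (2 * h ^+ 2) by rewrite mulr_ge0 // mulr_ge0 ?sqr_ge0.
have w0 : w 0%N = 0 by rewrite /w u0 mulr0.
have wN : w N = 0 by rewrite /w uN mulr0.
have wN1 : w N.+1 = 0 by rewrite /w uN1 mulr0.
have l0 : 0 < L ^+ 2 by rewrite exprn_gt0.
apply => //.
- move=> i iN; rewrite /wsinh /wcosh sinhRB -sinhRN; congr sinhR.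
  by have := dwt_step L h i; move: (dwt _ _ _) (dwt _ _ _) => a b <-; ring.
- by move=> i iN; rewrite /wsinh /wcosh sinh_cosh_diff -mulrBr dwt_step.
- by move=> i iN; apply: (wcosh_bounds (N := N)).
- by move=> i iN; apply: (wsinh_bounds (N := N)).
- by move=> i iN; apply: (wsinh_step (N := N)).
- by have := sinhR_ge K0; lra.
- move=> i iN.
  have [A1 _] := kdwt_bounds L0 h0 hN k0 kh iN.
  have [B1 _] := kdwt_bounds L0 h0 hN k0 kh (ltnW iN).
  apply: le_trans (coshR_sub1_ge (addr_ge0 A1 B1)).
  (* The vertex at [-L] keeps the slope of the weight above [2 L]. The square of [4 L k h] over
     eight, from [coshR_sub1_ge], is [2 l (k h)^2] with [l = L^2]. *)
  have H : 4 * L * (k * h) <= k * dwt L h i.+1 + k * dwt L h i.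
    rewrite -mulrDr mulrCA ler_wpM2l // !dwtE -mulrDr mulrC ler_wpM2l ?ltW //.
    have : 0 <= i.+1%:R * h by rewrite mulr_ge0 // ltW.
    have : 0 <= i%:R * h by rewrite mulr_ge0 // ltW.
    lra.
  have : (4 * L * (k * h)) ^+ 2 <= (k * dwt L h i.+1 + k * dwt L h i) ^+ 2.
    by rewrite lerXn2r ?nnegrE ?addr_ge0 // !mulr_ge0 // ltW.
  rewrite !exprMn; lra.
- have := ler_wpM2l (ltW a1) k23; lra.
- lra.
- have : 8 * c ^+ 3 / (2 * L ^+ 2) * (k ^+ 3 * tau) <= 1 by lra.
  rewrite mulrAC ler_pdivrMr // mul1r => Z.
  have := ler_wpM2l (ltW a2) k13; lra.
Qed.

End Weight.

(** * Cutoff functions *)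

Section Cutoff.
Variable R : realType.
Implicit Types (x y p l h : R).
Definition pos_sqr y : R := if y <= 0 then 0 else y ^+ 2.
(* A C^{1,1} step from 1 to 0 on [0, 2]; as a combination of truncated squares it
   has finite differences that are easy to bound. *)
Definition smooth_step y : R :=
  1 - (pos_sqr y - 2 * pos_sqr (y - 1) + pos_sqr (y - 2)) / 2.

Lemma smooth_stepE y : smooth_step y =
  if y <= 0 then 1 else if y <= 1 then 1 - y ^+ 2 / 2
  else if y <= 2 then (2 - y) ^+ 2 / 2 else 0.
Proof.
rewrite /smooth_step /pos_sqr.
case: (lerP y 0) => ?; case: (lerP (y-1) 0) => ?; case: (lerP (y-2) 0) => ?;
case: (lerP y 1) => ?; case: (lerP y 2) => ?; try lra; rewrite ?expr2; lra.
Qed.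
Lemma smooth_step_le0 y : y <= 0 -> smooth_step y = 1.
Proof. by rewrite smooth_stepE => ->. Qed.

Lemma smooth_step_ge2 y : 2 <= y -> smooth_step y = 0.
Proof.
rewrite smooth_stepE => H.
case: (lerP y 0) => ?; case: (lerP y 1) => ?; case: (lerP y 2) => ?; try lra.
have -> : y = 2 by lra.
by rewrite subrr expr0n mul0r.
Qed.

Lemma smooth_step_diff y y' : y <= y' -> 0 <= smooth_step y - smooth_step y' <= y' - y.
Proof.
(* [P] composes along chains, so it suffices to check it on each of the four pieces of
   [smooth_stepE]. *)
pose P a b := 0 <= smooth_step a - smooth_step b <= b - a.
have tr a b c : P a b -> P b c -> P a c.
  rewrite /P => /andP[? ?] /andP[? ?]; apply/andP; split; lra.
have E1 a : 0 <= a <= 1 -> smooth_step a = 1 - a ^+ 2 / 2.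
  move=> /andP[a0 a1]; rewrite smooth_stepE a1; case: (lerP a 0) => // ?.
  have -> : a = 0 by lra.
  by rewrite expr0n mul0r subr0.
have E2 a : 1 <= a <= 2 -> smooth_step a = (2 - a) ^+ 2 / 2.
  move=> /andP[a0 a1]; rewrite smooth_stepE a1; case: (lerP a 0) => // ?; first lra.
  case: (lerP a 1) => // ?.
  have -> : a = 1 by lra.
  rewrite expr1n; lra.
have C0 a b : a <= b -> b <= 0 -> P a b.
  by move=> ? ?; rewrite /P !smooth_step_le0 //; lra.
have C1 a b : a <= b -> 0 <= a -> b <= 1 -> P a b.
  move=> ? ? ?; rewrite /P !E1; try lra.
  have ? : 0 <= (b - a) * (b + a) by apply: mulr_ge0; lra.
  have ? : 0 <= (b - a) * (2 - (b + a)) by apply: mulr_ge0; lra.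
  by apply/andP; split; rewrite ?expr2; lra.
have C2 a b : a <= b -> 1 <= a -> b <= 2 -> P a b.
  move=> ? ? ?; rewrite /P !E2; try lra.
  have ? : 0 <= (b - a) * (4 - (b + a)) by apply: mulr_ge0; lra.
  have ? : 0 <= (b - a) * ((b + a) - 2) by apply: mulr_ge0; lra.
  by apply/andP; split; rewrite ?expr2; lra.
have C3 a b : a <= b -> 2 <= a -> P a b.
  by move=> ? ?; rewrite /P !smooth_step_ge2 //; lra.
have D2 a b : a <= b -> 1 <= a -> P a b.
  move=> ab a1; case: (lerP 2 a) => ?; first exact: C3.
  case: (lerP b 2) => ?; first exact: C2.
  by apply: (tr _ 2); [apply: C2 | apply: C3]; lra.
have D1 a b : a <= b -> 0 <= a -> P a b.
  move=> ab a1; case: (lerP 1 a) => ?; first exact: D2.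
  case: (lerP b 1) => ?; first by apply: C1.
  by apply: (tr _ 1); [apply: C1 | apply: D2]; lra.
move=> ab; case: (lerP 0 y) => ?; first exact: D1.
case: (lerP y' 0) => ?; first exact: C0.
by apply: (tr _ 0); [apply: C0 | apply: D1]; lra.
Qed.

Lemma smooth_step_bounds y : 0 <= smooth_step y <= 1.
Proof.
apply/andP; split.
  case: (lerP 2 y) => H; first by rewrite smooth_step_ge2.
  have := @smooth_step_diff y 2 (ltW H); rewrite (@smooth_step_ge2 2) // ; lra.
case: (lerP y 0) => H; first by rewrite smooth_step_le0.
have := @smooth_step_diff 0 y (ltW H); rewrite (@smooth_step_le0 0) // ; lra.
Qed.

Lemma pos_sqr_diff2 y h : 0 <= h ->
  0 <= pos_sqr (y + h) - 2 * pos_sqr y + pos_sqr (y - h) <= 2 * h ^+ 2.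
Proof.
move=> h0; rewrite /pos_sqr.
have ? : 0 <= (y - h) ^+ 2 by apply: sqr_ge0.
have ? : 0 <= (y + h) ^+ 2 by apply: sqr_ge0.
have ? : 0 <= h * h by apply: mulr_ge0.
case: (lerP (y + h) 0) => ?; case: (lerP y 0) => ?; case: (lerP (y - h) 0) => ?; try lra.
- have ? : 0 <= - y * (2 * h + y) by apply: mulr_ge0; lra.
  by apply/andP; split; rewrite ?expr2; lra.
- have ? : 0 <= y * (h - y) by apply: mulr_ge0; lra.
  by apply/andP; split; rewrite ?expr2; lra.
Qed.

Lemma smooth_step_diff2 y h : 0 <= h ->
  `|smooth_step (y + h) - 2 * smooth_step y + smooth_step (y - h)| <= 4 * h ^+ 2.
Proof.
move=> h0; rewrite /smooth_step.
have /andP[a1 a2] := pos_sqr_diff2 y h0.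
have /andP[b1 b2] := pos_sqr_diff2 (y - 1) h0.
have /andP[c1 c2] := pos_sqr_diff2 (y - 2) h0.
rewrite (addrAC y h (-1)) (addrAC y h (-2)) (addrAC y (-h) (-1)) (addrAC y (-h) (-2)).
by rewrite ler_norml; apply/andP; split; lra.
Qed.

End Cutoff.

Section CutoffPair.
Variable R : realType.

Definition grad_sq (h : R) (z : nat -> R) i : R :=
  ((z i.+2 - z i.+1) ^+ 2 + (z i.+1 - z i) ^+ 2) / h ^+ 2.

Lemma grad_sq_ge0 h z i : 0 <= grad_sq h z i.
Proof. by rewrite divr_ge0 ?addr_ge0 ?sqr_ge0. Qed.

Lemma sqr_add_le3 (a b c : R) : (a + b + c) ^+ 2 <= 3 * (a ^+ 2 + b ^+ 2 + c ^+ 2).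
Proof.
have := sqr_ge0 (a - b); have := sqr_ge0 (b - c); have := sqr_ge0 (a - c).
rewrite !expr2; lra.
Qed.

(** [chi] truncates the solution inside the window. [psi] equals 1 near the nodes where [chi] varies
    and is supported in the window, so that the source created by [chi] is controlled by a local
    energy. *)
Lemma cutoff_pair (l : R) : 0 < l -> exists c : R, 0 < c /\
  forall p h : R, 0 < h <= l -> exists chi psi : nat -> R,
  [/\ (forall i, 0 <= chi i <= 1),
      (forall i, i%:R * h <= p + 4 * l -> chi i = 1) &
      (forall i, p + 6 * l <= i%:R * h -> chi i = 0)] /\
  [/\ (forall i, 0 <= psi i <= 1),
      (forall i, ~~ (p <= i%:R * h <= p + 10 * l) -> psi i = 0),
      (forall i, `|psi i.+2 - 2 * psi i.+1 + psi i| <= c * h ^+ 2),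
      (forall i, ~~ (p <= i.+1%:R * h <= p + 10 * l) ->
         psi i.+2 - 2 * psi i.+1 + psi i = 0) &
      (forall (z : nat -> R) i,
        ((chi i.+2 - chi i.+1) * z i.+2 + (chi i - chi i.+1) * z i) ^+ 2 <=
        c * h ^+ 4 * (psi i.+1 * (grad_sq h z i + z i.+1 ^+ 2)))].
Proof.
(* [11 = 8 + 3]: second differences of [psi] cost [8 / l^2], those of two steps. The square of a sum
   of three terms costs [3 / l^2] for the first differences of [chi] and [3 * 16 / l^4] for the
   second one. *)
move=> l0; exists (11 / l ^+ 2 + 48 / l ^+ 4).
have i2 : 0 < 1 / l ^+ 2 by rewrite divr_gt0 ?exprn_gt0.
have i4 : 0 < 1 / l ^+ 4 by rewrite divr_gt0 ?exprn_gt0.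
split; first lra.
move=> p h /andP[h0 hl].
pose a (i : nat) := (i%:R * h - p) / l.
pose d := h / l.
have d0 : 0 <= d by rewrite divr_ge0 ?ltW.
have d1 : d <= 1 by rewrite ler_pdivrMr ?mul1r.
have aS i : a i.+1 = a i + d by rewrite /a /d -addn1 natrD; field; rewrite gt_eqF.
have aE i : i%:R * h = p + a i * l by rewrite /a divfK ?gt_eqF //; ring.
have aP (i : nat) (t : R) : (i%:R * h <= p + t * l) = (a i <= t).
  by rewrite aE lerD2l ler_pM2r.
have Pa (i : nat) (t : R) : (p + t * l <= i%:R * h) = (t <= a i).
  by rewrite aE lerD2l ler_pM2r.
have P0 i : (p <= i%:R * h) = (0 <= a i) by rewrite -Pa mul0r addr0.
(* In the unit [l] counted from [p], [chi] descends on [[4, 6]], while [psi] is 1 on [[3, 7]] and 0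
   outside [[1, 9]]. As [h <= l], the margins of one unit cover the neighbours of a node. *)
pose chi i := smooth_step (a i - 4).
pose psi i := smooth_step (a i - 7) - smooth_step (a i - 1).
have psi0 i : ~~ (1 <= a i <= 9) -> psi i = 0.
  rewrite negb_and -!ltNge => /orP[H|H]; rewrite /psi.
    by rewrite !smooth_step_le0 ?subrr //; lra.
  by rewrite !smooth_step_ge2 ?subrr //; lra.
have D2 (b : R) i : `|smooth_step (a i.+2 - b) - 2 * smooth_step (a i.+1 - b)
    + smooth_step (a i - b)| <= 4 * d ^+ 2.
  have := smooth_step_diff2 (a i.+1 - b) d0.
  have -> : a i.+1 - b + d = a i.+2 - b by rewrite (aS i.+1); ring.
  by have -> : a i.+1 - b - d = a i - b by rewrite (aS i); ring.
have dl : d ^+ 2 = 1 / l ^+ 2 * h ^+ 2 by rewrite /d; field; rewrite gt_eqF.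
have h20 : 0 <= h ^+ 2 by apply: sqr_ge0.
have h40 : 0 <= h ^+ 4 by rewrite exprn_ge0 // ltW.
exists chi, psi; split; split.
- by move=> i; apply: smooth_step_bounds.
- by move=> i; rewrite aP => H; rewrite /chi smooth_step_le0 //; lra.
- by move=> i; rewrite Pa => H; rewrite /chi smooth_step_ge2 //; lra.
- move=> i; rewrite /psi.
  have : a i - 7 <= a i - 1 by lra.
  move=> /smooth_step_diff /andP[-> _] /=.
  have /andP[? ?] := smooth_step_bounds (a i - 7).
  have /andP[? ?] := smooth_step_bounds (a i - 1).
  lra.
- move=> i; rewrite aP P0 => H; apply: psi0; apply: contra H => /andP[? ?].
  by apply/andP; split; lra.
- move=> i.
  have H7 := D2 7 i; have H1 := D2 1 i.
  have ? : 0 <= 1 / l ^+ 4 * h ^+ 2 by rewrite mulr_ge0 // ltW.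
  have ? : 0 <= 1 / l ^+ 2 * h ^+ 2 by rewrite mulr_ge0 // ltW.
  rewrite dl in H7 H1.
  move: H7 H1; rewrite /psi !ler_norml => /andP[? ?] /andP[? ?].
  by apply/andP; split; lra.
- move=> i; rewrite aP P0 negb_and -!ltNge => H.
  rewrite !psi0 ?mulr0 ?subr0 ?addr0 // negb_and -!ltNge;
    move: (aS i) (aS i.+1) => ? ?; case/orP: H => ?; apply/orP.
  + by left; lra.
  + by right; lra.
  + by left; lra.
  + by right; lra.
  + by left; lra.
  + by right; lra.
move=> z i.
have psig j : 0 <= psi j.
  rewrite /psi.
  have : a j - 7 <= a j - 1 by lra.
  by move=> /smooth_step_diff /andP[-> _].
have cge : 0 <= 11 / l ^+ 2 + 48 / l ^+ 4 by lra.
have rhs0 : 0 <= (11 / l ^+ 2 + 48 / l ^+ 4) * h ^+ 4 * (psi i.+1 * (grad_sq h z i + z i.+1 ^+ 2)).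
  apply: mulr_ge0; first exact: mulr_ge0.
  by apply: mulr_ge0 => //; apply: addr_ge0 (grad_sq_ge0 _ _ _) (sqr_ge0 _).
move: (aS i) (aS i.+1) => s1 s2.
case: (ltP (a i.+1) 3) => H3.
  have E j : a j <= 4 -> chi j = 1 by move=> ?; rewrite /chi smooth_step_le0 //; lra.
  by rewrite !E ?subrr ?mul0r ?addr0 ?expr0n //; lra.
case: (ltP 7 (a i.+1)) => H7.
  have E j : 6 <= a j -> chi j = 0 by move=> ?; rewrite /chi smooth_step_ge2 //; lra.
  by rewrite !E ?subrr ?mul0r ?addr0 ?expr0n //; lra.
have -> : psi i.+1 = 1.
  by rewrite /psi smooth_step_le0 ?smooth_step_ge2; lra.
rewrite mul1r.
(* Each product taken alone is only of order [h]. Regrouped, first differences of [chi] multiply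
   differences of [z], and only a second difference multiplies [z] itself. *)
have -> : (chi i.+2 - chi i.+1) * z i.+2 + (chi i - chi i.+1) * z i =
  (chi i.+2 - chi i.+1) * (z i.+2 - z i.+1) + (chi i.+1 - chi i) * (z i.+1 - z i)
  + (chi i.+2 - 2 * chi i.+1 + chi i) * z i.+1 by ring.
apply: (le_trans (sqr_add_le3 _ _ _)).
have C1 j : (chi j.+1 - chi j) ^+ 2 <= 1 / l ^+ 2 * h ^+ 2.
  rewrite -dl; apply: sqr_norm_le.
  have : a j - 4 <= a j.+1 - 4 by rewrite aS; lra.
  move=> /smooth_step_diff; rewrite -/(chi j) -/(chi j.+1) (aS j) => /andP[? ?].
  by rewrite ler_norml; apply/andP; split; lra.
have C2 : (chi i.+2 - 2 * chi i.+1 + chi i) ^+ 2 <= 16 * (1 / l ^+ 4 * h ^+ 4).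
  have := sqr_norm_le (D2 4 i); rewrite -/(chi i.+2) -/(chi i.+1) -/(chi i).
  have -> : (4 * d ^+ 2) ^+ 2 = 16 * (1 / l ^+ 4 * h ^+ 4).
    by rewrite dl; field; rewrite gt_eqF.
  by [].
rewrite !exprMn.
have := ler_wpM2r (sqr_ge0 (z i.+2 - z i.+1)) (C1 i.+1).
have := ler_wpM2r (sqr_ge0 (z i.+1 - z i)) (C1 i).
have := ler_wpM2r (sqr_ge0 (z i.+1)) C2.
set A := (z i.+2 - z i.+1) ^+ 2; set B := (z i.+1 - z i) ^+ 2; set Z := z i.+1 ^+ 2.
move=> K1 K2 K3.
have -> : (11 / l ^+ 2 + 48 / l ^+ 4) * h ^+ 4 * (grad_sq h z i + Z) =
  (11 * (1 / l ^+ 2) + 48 * (1 / l ^+ 4)) * (h ^+ 2 * (A + B) + h ^+ 4 * Z).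
  by rewrite /grad_sq -/A -/B; field; rewrite !gt_eqF.
have A0 : 0 <= A by apply: sqr_ge0. have B0 : 0 <= B by apply: sqr_ge0.
have Z0 : 0 <= Z by apply: sqr_ge0.
have q1 : 0 <= 1 / l ^+ 2 * (h ^+ 2 * (A + B)) by exact: mulr_ge0 (ltW i2) (mulr_ge0 h20 (addr_ge0 A0 B0)).
have q2 : 0 <= 1 / l ^+ 2 * (h ^+ 4 * Z) by exact: mulr_ge0 (ltW i2) (mulr_ge0 h40 Z0).
have q3 : 0 <= 1 / l ^+ 4 * (h ^+ 2 * (A + B)) by exact: mulr_ge0 (ltW i4) (mulr_ge0 h20 (addr_ge0 A0 B0)).
have q4 : 0 <= 1 / l ^+ 4 * (h ^+ 4 * Z) by exact: mulr_ge0 (ltW i4) (mulr_ge0 h40 Z0).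
lra.
Qed.

End CutoffPair.

(** * Energy estimates for the implicit step *)

Section LocalEnergy.
Variable R : realType.

(* Testing the implicit step against [psi z]: only second differences of [psi]
   appear because [2 z (delta^2 z) = delta^2 (z^2) - (forward difference)^2 - (backward difference)^2]. *)
Lemma local_energy_step N (h tau A : R) (psi b z zo : nat -> R) :
  0 < h -> 0 < tau -> (forall i, 0 <= psi i) -> z 0%N = 0 -> z N.+1 = 0 ->
  (forall i, (i < N)%N -> `|b i.+1| <= A) ->
  (forall i, (i < N)%N -> z i.+1 - zo i.+1 =
     tau * ((z i.+2 - 2 * z i.+1 + z i) / h ^+ 2 - b i.+1 * z i.+1)) ->
  \sum_(i < N) psi i.+1 * z i.+1 ^+ 2 + tau * \sum_(i < N) psi i.+1 * grad_sq h z i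
  <= \sum_(i < N) psi i.+1 * zo i.+1 ^+ 2
   + tau / h ^+ 2 * \sum_(i < N) (psi i.+2 - 2 * psi i.+1 + psi i) * z i.+1 ^+ 2
   + 2 * A * tau * \sum_(i < N) psi i.+1 * z i.+1 ^+ 2.
Proof.
move=> h0 t0 psi0 z0 zN HA Hz.
have hn : h != 0 by rewrite gt_eqF.
pose G i := psi i * z i.+1 ^+ 2 - psi i.+1 * z i ^+ 2.
have S : \sum_(i < N) (psi i.+1 * (z i.+2 ^+ 2 - 2 * z i.+1 ^+ 2 + z i ^+ 2)) <=
   \sum_(i < N) (psi i.+2 - 2 * psi i.+1 + psi i) * z i.+1 ^+ 2.
  rewrite -subr_ge0 -sumrB.
  rewrite (eq_bigr (fun i : 'I_N => - (G i.+1 - G i))); last first.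
    by move=> i _; rewrite /G; ring.
  rewrite sumrN sum_telescope /G z0 zN.
  have := mulr_ge0 (psi0 N.+1) (sqr_ge0 (z N)).
  have := mulr_ge0 (psi0 0%N) (sqr_ge0 (z 1%N)).
  lra.
have th : 0 <= tau / h ^+ 2 by rewrite divr_ge0 ?sqr_ge0 ?ltW.
have {}S := ler_wpM2l th S.
suff K : \sum_(i < N) psi i.+1 * z i.+1 ^+ 2 + tau * \sum_(i < N) psi i.+1 * grad_sq h z i
  - \sum_(i < N) psi i.+1 * zo i.+1 ^+ 2 - 2 * A * tau * \sum_(i < N) psi i.+1 * z i.+1 ^+ 2
  <= tau / h ^+ 2 * \sum_(i < N) (psi i.+1 * (z i.+2 ^+ 2 - 2 * z i.+1 ^+ 2 + z i ^+ 2)).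
  lra.
rewrite !mulr_sumr -big_split -!sumrB /=.
apply: ler_sum => i _.
have Hi := Hz i (ltn_ord i).
have /ler_normlP[b1 b2] := HA i (ltn_ord i).
have E1 : 0 <= psi i.+1 * (z i.+1 - zo i.+1) ^+ 2 by rewrite mulr_ge0 ?sqr_ge0.
have E2 : psi i.+1 * (2 * z i.+1 * (z i.+1 - zo i.+1)) =
  tau / h ^+ 2 * (psi i.+1 * (z i.+2 ^+ 2 - 2 * z i.+1 ^+ 2 + z i ^+ 2))
  - tau * (psi i.+1 * grad_sq h z i) - 2 * b i.+1 * tau * (psi i.+1 * z i.+1 ^+ 2).
  by rewrite Hi /grad_sq; field.
have E3 : - b i.+1 * (tau * (psi i.+1 * z i.+1 ^+ 2)) <= A * (tau * (psi i.+1 * z i.+1 ^+ 2)).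
  rewrite ler_wpM2r //.
  exact: mulr_ge0 (ltW t0) (mulr_ge0 (psi0 _) (sqr_ge0 _)).
rewrite !expr2 in E1 E2 E3 *; lra.
Qed.

(** The case [psi = 1]. It bounds the growth of the mass and, with [zo = 0], gives uniqueness for
    the implicit step. *)
Lemma energy_step N (h tau A : R) (b z zo : nat -> R) :
  0 < h -> 0 < tau -> z 0%N = 0 -> z N.+1 = 0 ->
  (forall i, (i < N)%N -> `|b i.+1| <= A) ->
  (forall i, (i < N)%N -> z i.+1 - zo i.+1 =
     tau * ((z i.+2 - 2 * z i.+1 + z i) / h ^+ 2 - b i.+1 * z i.+1)) ->
  (1 - 2 * A * tau) * \sum_(i < N) z i.+1 ^+ 2 <= \sum_(i < N) zo i.+1 ^+ 2.
Proof.
move=> h0 t0 z0 zN HA Hz.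
have := @local_energy_step N h tau A (fun=> 1) b z zo h0 t0 (fun=> ler01) z0 zN HA Hz.
rewrite -(big_mkord xpredT (fun i => 1 * z i.+1 ^+ 2)).
rewrite -(big_mkord xpredT (fun i => 1 * zo i.+1 ^+ 2)).
rewrite -(big_mkord xpredT (fun i => (1 - 2 * 1 + 1) * z i.+1 ^+ 2)).
under eq_bigr do rewrite mul1r.
under [\sum_(0 <= i < N) 1 * zo _ ^+ 2]eq_bigr do rewrite mul1r.
rewrite [X in _ / _ * X]big1 ?mulr0 ?addr0; last by move=> i _; ring.
rewrite !big_mkord => H.
have : 0 <= tau * \sum_(i < N) 1 * grad_sq h z i.
  apply: mulr_ge0; first exact: ltW.
  by apply: sumr_ge0 => i _; rewrite mul1r divr_ge0 ?addr_ge0 ?sqr_ge0.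
lra.
Qed.
End LocalEnergy.

(** * Carleman estimate with a parameter that varies in time *)

Section CarlemanTime.
Variable R : realType.

(** Time is reversed, so the adjoint problem is again an implicit forward step: level [0] is the
    final time of the control problem, and [b n] will be [a (M.+1 - n)]. *)
Definition adjoint_scheme N M (h tau : R) (b z : nat -> nat -> R) : Prop :=
  (forall n, (n <= M)%N -> z n 0%N = 0 /\ z n N.+1 = 0) /\
  (forall n i, (n < M)%N -> (i < N)%N ->
    z n.+1 i.+1 - z n i.+1 =
    tau * ((z n.+1 i.+2 - 2 * z n.+1 i.+1 + z n.+1 i) / h ^+ 2
           - b n.+1 i.+1 * z n.+1 i.+1)).

Definition mass N (z : nat -> R) : R := \sum_(i < N) z i.+1 ^+ 2.

Lemma mass_ge0 N z : 0 <= mass N z.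
Proof. by apply: sumr_ge0 => i _; apply: sqr_ge0. Qed.

(** The commutator of the second difference with the multiplication by [chi], at the node [i.+1]. *)
Definition cut_comm (chi z : nat -> R) i : R :=
  (chi i.+2 - chi i.+1) * z i.+2 + (chi i - chi i.+1) * z i.

Lemma expR_sub1_le (x : R) : `|x| <= 1 -> `|expR x - 1| <= expR 1 * `|x|.
Proof.
move=> H; have e1 : 1 <= expR 1 :> R by rewrite -[leLHS]expR0 ler_expR.
have G := expR_ge1Dx x; have G' := expR_ge1Dx (- x).
case: (lerP 0 x) => x0; last first.
  rewrite (ltr0_norm x0) ler0_norm; last by rewrite subr_le0 -[leRHS]expR0 ler_expR ltW.
  have := ler_peMl (_ : 0 <= - x) e1 ; rewrite oppr_ge0 => /(_ (ltW x0)); lra.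
rewrite (ger0_norm x0) in H *.
rewrite ger0_norm; last by lra.
have E := expR_mulN x.
have H1 : expR x <= expR 1 by rewrite ler_expR.
have H2 := ler_wpM2l (expR_ge0 x) G'.
have H3 := ler_wpM2l x0 H1.
lra.
Qed.

(** Writing [k = kap^2] makes [k^(3/2)], the size of the time variation of the weight, an integer
    power. [carleman_wt] is applied to [w'] at the new level and to [w] at the old level with its
    own weight; the residual then consists of the potential, the commutator of the cutoff and the
    variation of the weight. Their cost leaves [3/2] at the new level against [1/2] at the old one,
    a surplus after summation. *)
Lemma carleman_time_step (L A : R) : 0 < L -> 0 <= A ->
  exists delta Lam eta : R, [/\ 0 < delta, 0 < eta &
  forall N (h tau kap kap' : R) (chi b z z' : nat -> R),
  0 < h -> N.+1%:R * h = L -> 0 < tau ->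
  1 <= kap -> 1 <= kap' -> kap ^+ 2 * h <= 1 -> kap' ^+ 2 * h <= 1 ->
  kap ^+ 6 * tau <= eta -> kap' ^+ 6 * tau <= eta -> Lam <= kap' ^+ 6 ->
  kap' ^+ 2 <= 4 * kap ^+ 2 ->
  `|kap' ^+ 2 - kap ^+ 2| <= delta * tau * kap ^+ 3 ->
  chi N = 0 -> z 0%N = 0 -> z N.+1 = 0 -> z' 0%N = 0 -> z' N.+1 = 0 ->
  (forall i, (i < N)%N -> `|b i.+1| <= A) ->
  (forall i, (i < N)%N -> z' i.+1 - z i.+1 =
    tau * ((z' i.+2 - 2 * z' i.+1 + z' i) / h ^+ 2 - b i.+1 * z' i.+1)) ->
  let k := kap ^+ 2 in let k' := kap' ^+ 2 in
  forall w w' : nat -> R,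
  (forall i, w i = expR (k * wt L h i) * (chi i * z i)) ->
  (forall i, w' i = expR (k' * wt L h i) * (chi i * z' i)) ->
  symm_form N (wcosh L h k') w' / h ^+ 2 + 3 / 2 * L ^+ 2 * (tau * kap' ^+ 6 * mass N w') <=
  symm_form N (wcosh L h k) w / h ^+ 2 + L ^+ 2 / 2 * (tau * kap ^+ 6 * mass N w)
  + 3 * tau * \sum_(i < N) (expR (k' * wt L h i.+1) * cut_comm chi z' i / h ^+ 2) ^+ 2].
Proof.
move=> L0 A0.
have [eta [eta0 CW]] := carleman_wt L0.
set c := wconst L; have c0 : 0 < c := wconst_gt0 L0.
pose K := 4 * L ^+ 2 + 1.
have K1 : 1 <= K by rewrite /K; have := sqr_ge0 L; lra.
have L2 : 0 < L ^+ 2 by rewrite exprn_gt0.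
set e := expR 1 : R.
have e0 : 0 < e by apply: expR_gt0.
(* The first summand comes from the change of the form between the levels, the second from the time
   quotient of the weight; [delta] brings their total cost below [L^2 / 2]. *)
pose D := 10 * c ^+ 2 + 3 * (e * K) ^+ 2.
have D0 : 0 < D.
  by rewrite /D; have := sqr_ge0 (e * K); have := exprn_gt0 2 c0; lra.
pose delta := Num.min 1 (L ^+ 2 / 2 / D).
have d0 : 0 < delta by rewrite lt_min ltr01 !divr_gt0.
have d1 : delta <= 1 by rewrite ge_min lexx.
have dD : delta * D <= L ^+ 2 / 2 by rewrite -ler_pdivlMr // ge_min lexx orbT.
(* The second witness makes [3 A^2], the cost of the potential, at most [L^2 / 2 * kap'^6]. The
   bound [K^-1] keeps the exponent [(k' - k) * wt] within [[-1, 1]], as [expR_sub1_le] requires. *)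
exists delta, (6 * A ^+ 2 / L ^+ 2), (Num.min eta K^-1).
have Kg : 0 < K by lra.
split=> //; first by rewrite lt_min eta0 invr_gt0.
move=> N h tau kap kap' chi b z z' h0 hN t0 kp kp' kh kh' kt kt' HL k4 dk chiN.
move=> z0 zN z'0 z'N HA Hz k k' w w' Hw Hw'.
have k1 : 1 <= k by rewrite expr_ge1 // (le_trans ler01).
have k'1 : 1 <= k' by rewrite expr_ge1 // (le_trans ler01).
have k0 : 0 <= k by lra. have k'0 : 0 <= k' by lra.
have kapg : 0 < kap by lra. have kapg' : 0 < kap' by lra.
have E6 : kap ^+ 6 = k ^+ 3 by rewrite -exprM.
have E6' : kap' ^+ 6 = k' ^+ 3 by rewrite -exprM.
rewrite !le_min !(mulrC _ tau) in kt kt'.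
case/andP: kt => kt ktK; case/andP: kt' => kt' kt'K.
rewrite E6 in kt ktK *; rewrite E6' in kt' kt'K HL *.
have w0 : w 0%N = 0 by rewrite Hw z0 !mulr0.
have wN1 : w N.+1 = 0 by rewrite Hw zN !mulr0.
have W := CW N h tau k' (fun i => chi i * z' i) w w' h0 hN t0 k'1 kh'.
rewrite (mulrC _ tau) z'0 z'N chiN !mulr0 mul0r in W.
have {}W := W kt' erefl erefl erefl w0 wN1 Hw'.
rewrite -/(mass N w') in W.
have hn : h != 0 by rewrite gt_eqF.
have tn : tau != 0 by rewrite gt_eqF.
have k36 : kap ^+ 3 <= kap ^+ 6 by rewrite ler_weXn2l.
have tK : delta * tau * kap ^+ 3 * K <= 1.
  have X1 : tau * kap ^+ 6 * K <= 1 by rewrite E6 -ler_pdivlMr // div1r.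
  have X2 : 0 <= tau * kap ^+ 3 * K.
    exact: mulr_ge0 (mulr_ge0 (ltW t0) (exprn_ge0 3 (ltW kapg))) (ltW Kg).
  have X3 := ler_wpM2r X2 d1.
  have X4 := ler_wpM2l (mulr_ge0 (ltW t0) (ltW Kg)) k36.
  lra.
have fpt i : (i < N)%N ->
  ((w' i.+1 - w i.+1) / tau - expR (k' * wt L h i.+1) *
     (chi i.+2 * z' i.+2 - 2 * (chi i.+1 * z' i.+1) + chi i * z' i) / h ^+ 2) ^+ 2 <=
  3 * (A ^+ 2 * w' i.+1 ^+ 2 +
      (expR (k' * wt L h i.+1) * cut_comm chi z' i / h ^+ 2) ^+ 2 +
      (e * K) ^+ 2 * delta ^+ 2 * (k ^+ 3 * w i.+1 ^+ 2)).
  move=> iN.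
  (* [E] converts the old weight carried by [w] into the new one; [(E - 1) / tau] is the discrete
     time derivative of the weight. *)
  set E := expR ((k' - k) * wt L h i.+1).
  have EE : expR (k' * wt L h i.+1) * (chi i.+1 * z i.+1) = E * w i.+1.
    by rewrite Hw [RHS]mulrA /E -expRD -mulrDl subrK.
  have -> : (w' i.+1 - w i.+1) / tau - expR (k' * wt L h i.+1) *
     (chi i.+2 * z' i.+2 - 2 * (chi i.+1 * z' i.+1) + chi i * z' i) / h ^+ 2 =
     - b i.+1 * w' i.+1 + - (expR (k' * wt L h i.+1) * cut_comm chi z' i / h ^+ 2)
     + (E - 1) / tau * w i.+1.
    have X : (w' i.+1 - w i.+1) / tau =
      expR (k' * wt L h i.+1) * chi i.+1 * ((z' i.+1 - z i.+1) / tau) + (E - 1) / tau * w i.+1.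
      rewrite [(E - 1) / tau * _]mulrAC [(E - 1) * _]mulrBl -EE Hw'; field.
      by rewrite tn.
    rewrite X Hz // Hw' /cut_comm; field.
    by rewrite tn hn.
  apply: (le_trans (sqr_add_le3 _ _ _)).
  rewrite ler_pM2l // lerD ?lerD //.
  - rewrite exprMn ler_wpM2r ?sqr_ge0 //; apply: sqr_norm_le.
    by rewrite normrN HA.
  - by rewrite sqrrN.
  rewrite exprMn [leRHS]mulrA ler_wpM2r ?sqr_ge0 //.
  have B : `|wt L h i.+1| <= K.
    have /andP[] := wt_bounds L0 h0 hN (ltnW iN : (i.+1 <= N.+1)%N).
    by rewrite -/K => ? ?; rewrite ler_norml; apply/andP; split; lra.
  have X : `|(k' - k) * wt L h i.+1| <= delta * tau * kap ^+ 3 * K.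
    by rewrite normrM ler_pM.
  have Y := expR_sub1_le (le_trans X tK).
  have Z : `|(E - 1) / tau| <= e * K * delta * kap ^+ 3.
    rewrite normrM normfV (gtr0_norm t0) ler_pdivrMr //.
    apply: (le_trans Y); rewrite -/e.
    apply: (le_trans (ler_wpM2l (ltW e0) X)).
    by rewrite le_eqVlt; apply/orP; left; apply/eqP; ring.
  apply: (le_trans (sqr_norm_le Z)).
  by rewrite -E6 le_eqVlt; apply/orP; left; apply/eqP; ring.
have FS := ler_sum _ (fun (i : 'I_N) _ => fpt i (ltn_ord i)).
have {FS}W := le_trans W (FS _ _).
rewrite -mulr_sumr !big_split /= -!mulr_sumr -/(mass N w) -/(mass N w') in W.
have ht : 0 < h ^+ 2 * tau by rewrite mulr_gt0 ?exprn_gt0.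
(* To telescope in time, the form of the old level must carry its own coefficients. *)
have QD : symm_form N (wcosh L h k') w - symm_form N (wcosh L h k) w <=
   10 * c ^+ 2 * delta * tau * k ^+ 3 * h ^+ 2 * mass N w.
  have cc : 0 <= c ^+ 2 * ((k' + k) * `|k' - k| * h ^+ 2).
    by rewrite mulr_ge0 ?sqr_ge0 // mulr_ge0 ?sqr_ge0 // mulr_ge0 // addr_ge0.
  have HC i : (i < N)%N -> `|wcosh L h k' i.+1 - wcosh L h k i.+1| <=
      c ^+ 2 * ((k' + k) * `|k' - k| * h ^+ 2).
    by move=> iN; apply: (@wcosh_diff _ L h k' k N).
  apply: (le_trans (form_diff_le HC cc wN1)).
  rewrite -/(mass N w) ler_wpM2r ?mass_ge0 //.
  have Y : (k' + k) * `|k' - k| <= (5 * k) * (delta * tau * kap ^+ 3).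
    apply: ler_pM => //; first exact: addr_ge0.
    rewrite /k' /k; lra.
  have Y2 : (5 * k) * (delta * tau * kap ^+ 3) <= 5 * delta * tau * k ^+ 3.
    have -> : (5 * k) * (delta * tau * kap ^+ 3) = 5 * delta * tau * kap ^+ 5.
      by rewrite /k; ring.
    rewrite -E6 ler_wpM2l ?ler_weXn2l //.
    exact: mulr_ge0 (mulr_ge0 (ler0n _ 5) (ltW d0)) (ltW t0).
  have := ler_wpM2l (mulr_ge0 (sqr_ge0 c) (sqr_ge0 h)) (le_trans Y Y2).
  lra.
have M0 := mass_ge0 N w; have M0' := mass_ge0 N w'.
have h20 : 0 < h ^+ 2 by rewrite exprn_gt0.
have QD' : (symm_form N (wcosh L h k') w - symm_form N (wcosh L h k) w) / h ^+ 2 <=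
   10 * c ^+ 2 * delta * (tau * k ^+ 3 * mass N w).
  by rewrite ler_pdivrMr //; lra.
have HA2 : 3 * A ^+ 2 * (tau * mass N w') <= L ^+ 2 / 2 * (tau * k' ^+ 3 * mass N w').
  move: HL; rewrite ler_pdivrMr // => HL.
  have := ler_wpM2r (mulr_ge0 (ltW t0) M0') HL; lra.
have Dd : 10 * c ^+ 2 * delta + 3 * ((e * K) ^+ 2 * delta ^+ 2) <= L ^+ 2 / 2.
  apply: le_trans dD.
  have : (e * K) ^+ 2 * delta ^+ 2 <= (e * K) ^+ 2 * delta.
    by rewrite ler_wpM2l ?sqr_ge0 // expr2 ler_piMl // ltW.
  rewrite /D; lra.
have tkM : 0 <= tau * k ^+ 3 * mass N w.
  exact: mulr_ge0 (mulr_ge0 (ltW t0) (exprn_ge0 3 k0)) M0.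
have Dd' := ler_wpM2r tkM Dd.
have := ler_wpM2l (ltW t0) W.
have -> : tau * ((symm_form N (wcosh L h k') w' - symm_form N (wcosh L h k') w) /
   (h ^+ 2 * tau) + 2 * L ^+ 2 * k' ^+ 3 * mass N w') =
   symm_form N (wcosh L h k') w' / h ^+ 2 - symm_form N (wcosh L h k') w / h ^+ 2
   + 2 * L ^+ 2 * (tau * k' ^+ 3 * mass N w') by field; rewrite tn hn.
move=> W'.
rewrite mulrBl in QD'.
lra.
Qed.

End CarlemanTime.

(** * Summation in time and the Caccioppoli inequality *)

Section Caccioppoli.
Variable R : realType.

(** Of the two comparisons between consecutive levels, the first serves the Carleman step and the
    second the Caccioppoli inequality. *)
Definition admissible_weight M (h tau delta Lam eta : R) (kap : nat -> R) : Prop :=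
  (forall n, (n <= M)%N ->
    [/\ 1 <= kap n, kap n ^+ 2 * h <= 1, kap n ^+ 6 * tau <= eta & Lam <= kap n ^+ 6]) /\
  (forall n, (n < M)%N ->
    [/\ kap n.+1 ^+ 2 <= 4 * kap n ^+ 2, kap n ^+ 2 <= 4 * kap n.+1 ^+ 2 &
        `|kap n.+1 ^+ 2 - kap n ^+ 2| <= delta * tau * kap n ^+ 3]).

Definition window_mass N (h a b : R) (z : nat -> R) : R :=
  \sum_(i < N | a <= i.+1%:R * h <= b) z i.+1 ^+ 2.

Lemma window_mass_ge0 N h a b z : 0 <= window_mass N h a b z.
Proof. by apply: sumr_ge0 => i _; apply: sqr_ge0. Qed.

Lemma sum_recursion M (a : R) (q D S : nat -> R) : 0 <= a -> (forall n, 0 <= D n) ->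
  (forall n, (n < M)%N ->
     q n.+1 + 3 / 2 * a * D n.+1 <= q n + a / 2 * D n + S n.+1) ->
  q M + a * \sum_(n < M) D n.+1 <= q 0%N + a / 2 * D 0%N + \sum_(n < M) S n.+1.
Proof.
move=> a0 D0 H.
(* The claim is strengthened by [a / 2 * D M], which pays for the old-level term of the next
   step. *)
suff : q M + a / 2 * D M + a * \sum_(n < M) D n.+1
    <= q 0%N + a / 2 * D 0%N + \sum_(n < M) S n.+1.
  by have := mulr_ge0 a0 (D0 M); lra.
elim: M H => [|M IH] H; first by rewrite !big_ord0; lra.
rewrite !big_ord_recr /=.
have := IH (fun n nM => H n (ltnW nM)); have := H M (leqnn _); lra.
Qed.

Lemma expRN_diff_le (x y m : R) : m <= x -> m <= y ->
  expR (- x) - expR (- y) <= `|x - y| * expR (- m).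
Proof.
move=> mx my.
have E : expR (- y) = expR (- x) * expR (x - y) by rewrite -expRD; congr expR; lra.
have G := expR_ge1Dx (x - y).
have H : expR (- x) - expR (- y) <= expR (- x) * (y - x).
  rewrite E; have := ler_wpM2l (expR_ge0 (- x)) G; lra.
apply: (le_trans H); rewrite mulrC.
have H2 : expR (- x) <= expR (- m) by rewrite ler_expR; lra.
apply: (@le_trans _ _ (`|x - y| * expR (- x))); last by rewrite ler_wpM2l.
by rewrite ler_wpM2r ?expR_ge0 // distrC ler_norm.
Qed.

Lemma sqr_expRN_le (x : R) : 0 <= x -> x ^+ 2 * expR (- x) <= 4.
Proof.
move=> x0.
have H := expR_ge1Dx (x / 2).
have H2 : (x / 2) ^+ 2 <= expR x.
  rewrite expR_half lerXn2r ?nnegrE ?expR_ge0 ?divr_ge0 //; lra.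
have := ler_wpM2r (expR_ge0 (- x)) H2; rewrite expR_mulN !expr2; lra.
Qed.

(** Removes the gradients that the cutoff produces, since only [z] is observed. The local energy is
    weighted in time by [rho n = expR (- (2 k_n))], whose increments are of order [tau] uniformly in
    [k], because [k^(3/2) expR (- k / 2)] is bounded. *)
Lemma caccioppoli (A c d h tau p l : R) N M (kap psi : nat -> R) (b z : nat -> nat -> R) :
  0 < h -> 0 < tau -> 0 <= A -> 0 <= c -> 0 <= d -> (0 < M)%N ->
  (forall n, (n <= M)%N -> 1 <= kap n) ->
  (forall n, (n < M)%N ->  kap n ^+ 2 <= 4 * kap n.+1 ^+ 2) ->
  (forall n, (n < M)%N ->
     `|kap n.+1 ^+ 2 - kap n ^+ 2| <= d * tau * kap n ^+ 3) ->
  (forall i, 0 <= psi i <= 1) ->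
  (forall i, ~~ (p <= i%:R * h <= l) -> psi i = 0) ->
  (forall i, `|psi i.+2 - 2 * psi i.+1 + psi i| <= c * h ^+ 2) ->
  (forall i, ~~ (p <= i.+1%:R * h <= l) -> psi i.+2 - 2 * psi i.+1 + psi i = 0) ->
  adjoint_scheme N M h tau b z ->
  (forall n i, (n < M)%N -> (i < N)%N -> `|b n.+1 i.+1| <= A) ->
  \sum_(n < M) tau * (expR (- (2 * kap n.+1 ^+ 2)) *
      \sum_(i < N) psi i.+1 * (grad_sq h (z n.+1) i + z n.+1 i.+1 ^+ 2)) <=
  expR (- (kap 0%N ^+ 2 / 2)) * mass N (z 0%N) +
  (c + 2 * A + 32 * d + 1) * \sum_(n < M) tau * window_mass N h p l (z n.+1).
Proof.
move=> h0 t0 A0 c0 d0 M0 k1 k4 dk psi1 psiS dpsi dpsiS [zb zs] HA.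
pose rho n := expR (- (2 * kap n ^+ 2)).
pose Psi n := \sum_(i < N) psi i.+1 * z n i.+1 ^+ 2.
pose Gr n := \sum_(i < N) psi i.+1 * grad_sq h (z n) i.
pose O n := window_mass N h p l (z n).
have psi0 i : 0 <= psi i by case/andP: (psi1 i).
have PO n : Psi n <= O n.
  rewrite /Psi /O /window_mass [leRHS]big_mkcond /=; apply: ler_sum => i _.
  case: ifP => H; last by rewrite psiS ?H // mul0r.
  by case/andP: (psi1 i.+1) => _ H1; rewrite ler_piMl ?sqr_ge0.
have Psi0 n : 0 <= Psi n by apply: sumr_ge0 => i _; rewrite mulr_ge0 ?sqr_ge0.
have O0 n : 0 <= O n by apply: window_mass_ge0.
have Gr0 n : 0 <= Gr n by apply: sumr_ge0 => i _; rewrite mulr_ge0 ?grad_sq_ge0.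
have rho0 n : 0 <= rho n by apply: expR_ge0.
have rho1 n : rho n <= 1.
  by rewrite -expR0 ler_expR oppr_le0 mulr_ge0 ?sqr_ge0.
have step n : (n < M)%N -> Psi n.+1 + tau * Gr n.+1 <= Psi n + tau * ((c + 2 * A) * O n.+1).
  move=> nM; have [zb0 zbN] := zb n.+1 nM.
  have := local_energy_step h0 t0 psi0 zb0 zbN (fun i iN => HA n i nM iN)
    (fun i iN => zs n i nM iN).
  rewrite -/(Psi n) -/(Psi n.+1) -/(Gr n.+1) => E.
  have X : \sum_(i < N) (psi i.+2 - 2 * psi i.+1 + psi i) * z n.+1 i.+1 ^+ 2 <= c * h ^+ 2 * O n.+1.
    rewrite /O /window_mass mulr_sumr [leRHS]big_mkcond /=; apply: ler_sum => i _.
    case: ifP => H; last by rewrite dpsiS ?H // mul0r.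
    by rewrite ler_wpM2r ?sqr_ge0 // (le_trans (ler_norm _)).
  have th : 0 <= tau / h ^+ 2 by rewrite divr_ge0 ?sqr_ge0 ?ltW.
  have {}X := ler_wpM2l th X.
  have Y : tau / h ^+ 2 * (c * h ^+ 2 * O n.+1) = tau * (c * O n.+1) by field; rewrite gt_eqF.
  rewrite Y in X.
  have Z := ler_wpM2l (mulr_ge0 A0 (ltW t0)) (PO n.+1).
  lra.
(* [32 = 2 * 16]: the 2 is the factor in the exponent, and 16 bounds [kap^4 expR (- kap^2 / 2)],
   that is four times the quantity of [sqr_expRN_le] at [kap^2 / 2]. *)
have drho n : (n < M)%N -> rho n.+1 - rho n <= 32 * d * tau.
  move=> nM; have K1 := k1 n (ltnW nM); have K4 := k4 n nM.
  have K2 : 1 <= kap n ^+ 2 by rewrite expr_ge1 // (le_trans ler01).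
  have m1 : kap n ^+ 2 / 2 <= 2 * kap n.+1 ^+ 2 by lra.
  have m2 : kap n ^+ 2 / 2 <= 2 * kap n ^+ 2 by lra.
  apply: (le_trans (expRN_diff_le m1 m2)).
  have D := dk n nM.
  have -> : `|2 * kap n.+1 ^+ 2 - 2 * kap n ^+ 2| = 2 * `|kap n.+1 ^+ 2 - kap n ^+ 2|.
    by rewrite -mulrBr normrM ger0_norm.
  have := ler_wpM2r (expR_ge0 (- (kap n ^+ 2 / 2))) D.
  have P0 : 0 <= kap n ^+ 2 / 2 by lra.
  have S := sqr_expRN_le P0.
  have k34 : kap n ^+ 3 <= kap n ^+ 4 by rewrite ler_weXn2l.
  have S' : kap n ^+ 3 * expR (- (kap n ^+ 2 / 2)) <= 16.
    have := ler_wpM2r (expR_ge0 (- (kap n ^+ 2 / 2))) k34.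
    have -> : kap n ^+ 4 * expR (- (kap n ^+ 2 / 2)) =
      4 * ((kap n ^+ 2 / 2) ^+ 2 * expR (- (kap n ^+ 2 / 2))) by field.
    lra.
  have := ler_wpM2l (mulr_ge0 d0 (ltW t0)) S'.
  lra.
(* The term [32 * d * tau * O m.+1] on the left pays for replacing [rho m.+1] by [rho m.+2] in front
   of [Psi m.+1] at the next step. *)
have main m : (m < M)%N ->
  rho m.+1 * Psi m.+1 + 32 * d * tau * O m.+1 + \sum_(n < m.+1) tau * (rho n.+1 * Gr n.+1)
  <= rho 1%N * Psi 0%N + (c + 2 * A + 32 * d) * \sum_(n < m.+1) tau * O n.+1.
  have base n : (n < M)%N -> rho n.+1 * Psi n.+1 + tau * (rho n.+1 * Gr n.+1) <=
      rho n.+1 * Psi n + (c + 2 * A) * (tau * O n.+1).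
    move=> nM; have := ler_wpM2l (rho0 n.+1) (step n nM).
    have cA : 0 <= c + 2 * A by lra.
    have := ler_wpM2r (mulr_ge0 cA (mulr_ge0 (ltW t0) (O0 n.+1))) (rho1 n.+1).
    lra.
  elim: m => [|m IH] mM.
    by rewrite !big_ord_recr !big_ord0 /=; have := base 0%N mM; lra.
  have {}IH := IH (ltnW mM).
  rewrite big_ord_recr [X in _ <= _ + _ * X]big_ord_recr /=.
  have B := base m.+1 mM.
  have X := ler_wpM2r (Psi0 m.+1) (drho m.+1 mM).
  have dt : 0 <= 32 * d * tau by rewrite mulr_ge0 ?mulr_ge0 ?(ltW t0).
  have Y := ler_wpM2l dt (PO m.+1).
  lra.
case: M M0 k1 k4 dk zb zs HA step drho main => // M _ k1 k4 dk _ _ _ _ _ main.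
have {}main := main M (leqnn _).
(* The first step carries [rho 1], not [rho 0]. Comparability of the two levels turns [2 kap_1^2]
   into [kap_0^2 / 2], whence the half in the exponent. *)
have r1 : rho 1%N <= expR (- (kap 0%N ^+ 2 / 2)).
  by rewrite ler_expR; have := k4 0%N isT; lra.
have PM : Psi 0%N <= mass N (z 0%N).
  apply: ler_sum => i _.
  by case/andP: (psi1 i.+1) => _ H1; rewrite ler_piMl ?sqr_ge0.
have X1 := ler_wpM2r (Psi0 0%N) r1.
have X2 := ler_wpM2l (expR_ge0 (- (kap 0%N ^+ 2 / 2))) PM.
have X3 := mulr_ge0 (rho0 M.+1) (Psi0 M.+1).
have dt : 0 <= 32 * d * tau by rewrite mulr_ge0 ?mulr_ge0 ?(ltW t0).
have X4 := mulr_ge0 dt (O0 M.+1).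
have X5 : \sum_(n < M.+1) tau * (rho n.+1 * Psi n.+1) <= \sum_(n < M.+1) tau * O n.+1.
  apply: ler_sum => n _; rewrite ler_pM2l //.
  apply: le_trans (PO n.+1); rewrite ler_piMl //.
have -> : \sum_(n < M.+1) tau * (expR (- (2 * kap n.+1 ^+ 2)) *
      \sum_(i < N) psi i.+1 * (grad_sq h (z n.+1) i + z n.+1 i.+1 ^+ 2)) =
  \sum_(n < M.+1) tau * (rho n.+1 * Gr n.+1) + \sum_(n < M.+1) tau * (rho n.+1 * Psi n.+1).
  rewrite -big_split /=; apply: eq_bigr => n _; rewrite -!mulrDr -big_split /=.
  by congr (_ * (_ * _)); apply: eq_bigr => i _; rewrite mulrDr.
rewrite -/(O _); lra.
Qed.

End Caccioppoli.

(** * Observation of the part of the domain left of the window *)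

Section LeftSideObservability.
Variable R : realType.

Lemma weighted_mass_le N (L h k : R) (chi z w : nat -> R) :
  0 < L -> 0 < h -> N.+1%:R * h = L -> 0 <= k -> (forall i, 0 <= chi i <= 1) ->
  (forall i, w i = expR (k * wt L h i) * (chi i * z i)) ->
  mass N w <= expR (- (2 * k)) * mass N z.
Proof.
move=> L0 h0 hN k0 Hchi Hw; rewrite /mass mulr_sumr; apply: ler_sum => i _.
rewrite Hw 2!exprMn.
have -> : expR (k * wt L h i.+1) ^+ 2 = expR (2 * (k * wt L h i.+1)).
  by rewrite [RHS]expR_half; congr (expR _ ^+ 2); field.
apply: ler_pM; first exact: expR_ge0.
- exact: mulr_ge0 (sqr_ge0 _) (sqr_ge0 _).
- rewrite ler_expR.
  have /andP[_ B] := wt_bounds L0 h0 hN (ltnW (ltn_ord i) : (i.+1 <= N.+1)%N).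
  have := ler_wpM2l k0 B; lra.
case/andP: (Hchi i.+1) => c0 c1.
by rewrite ler_piMl ?sqr_ge0 // exprn_ile1.
Qed.

(** Sums the Carleman step in time: [caccioppoli] controls the source due to the cutoff, and the
    forms at the two end levels become the terms over [h^2]. Since [delta], [Lam] and [eta] come
    before [p] and [l], one time weight can serve a window and its reflection. The exponent on the
    left is twice the lower bound of the space weight. *)
Lemma left_observability (L A : R) : 0 < L -> 0 <= A ->
  exists delta Lam eta : R, [/\ 0 < delta, 0 < eta &
  forall p l : R, 0 <= p -> 0 < l -> p + 10 * l <= L -> exists C : R, 0 < C /\
  forall N M (h tau : R) (kap : nat -> R) (b z : nat -> nat -> R),
  0 < h -> h <= l -> N.+1%:R * h = L -> 0 < tau -> (0 < M)%N ->
  admissible_weight M h tau delta Lam eta kap ->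
  adjoint_scheme N M h tau b z ->
  (forall n i, (n < M)%N -> (i < N)%N -> `|b n.+1 i.+1| <= A) ->
  \sum_(n < M) tau * (expR (- (2 * (4 * L ^+ 2 + 1) * kap n.+1 ^+ 2)) *
     window_mass N h 0 (p + 4 * l) (z n.+1)) <=
  C * (\sum_(n < M) tau * window_mass N h p (p + 10 * l) (z n.+1) +
     (expR (- (kap 0%N ^+ 2 / 2)) * mass N (z 0%N) +
      expR (- (2 * kap M ^+ 2)) * mass N (z M)) / h ^+ 2)].
Proof.
move=> L0 A0.
have [delta [Lam [eta [d0 e0 Hstep]]]] := carleman_time_step L0 A0.
exists delta, Lam, eta; split=> // p l p0 l0 pl.
have [cl [cl0 Hcut]] := cutoff_pair l0.
set c := wconst L; have c0 : 0 < c := wconst_gt0 L0.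
have L20 : 0 < L ^+ 2 by rewrite exprn_gt0.
pose B := cl + 2 * A + 32 * delta + 1.
have B0 : 0 < B by rewrite /B; lra.
(* The initial terms: [4 + 2 c] bounds a form with coefficients at most [1 + c], and the rest bounds
   [L^2 / 2 * D 0] through [kap^6 tau <= eta] and [h <= L]. *)
pose B2 := (4 + 2 * c) + L ^+ 2 / 2 * eta * L ^+ 2.
have B20 : 0 < B2.
  by rewrite /B2; have := mulr_gt0 (mulr_gt0 (divr_gt0 L20 (ltr0n R 2)) e0) L20; lra.
pose C := (3 * cl * B + 3 * cl * L ^+ 2 + B2 + 2 * c) / L ^+ 2.
have clB : 0 < cl * B by rewrite mulr_gt0.
have clL : 0 < cl * L ^+ 2 by rewrite mulr_gt0.
exists C; split; first by rewrite divr_gt0 //; lra.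
move=> N M h tau kap b z h0 hl hN t0 M0 [adm1 adm2] Hz HA.
have [chi [psi [[chi1 chiL chiR] [psi1 psiS dpsi dpsiS src]]]] := Hcut p h (introT andP (conj h0 hl)).
have hn : h != 0 by rewrite gt_eqF.
have h20 : 0 < h ^+ 2 by rewrite exprn_gt0.
have chiN : chi N = 0.
  by apply: chiR; move: hN; rewrite -addn1 natrD mulrDl mul1r; lra.
have [zb zs] := Hz.
pose w n i := expR (kap n ^+ 2 * wt L h i) * (chi i * z n i).
pose T n := \sum_(i < N) psi i.+1 * (grad_sq h (z n) i + z n i.+1 ^+ 2).
pose q n := symm_form N (wcosh L h (kap n ^+ 2)) (w n) / h ^+ 2.
pose D n := tau * kap n ^+ 6 * mass N (w n).
pose S n := 3 * cl * (tau * (expR (- (2 * kap n ^+ 2)) * T n)).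
have tk0 n : 0 <= tau * kap n ^+ 6 by rewrite mulr_ge0 ?exprn_even_ge0 ?ltW.
have D0 n : 0 <= D n by rewrite mulr_ge0 ?mass_ge0.
have rec n : (n < M)%N ->
     q n.+1 + 3 / 2 * L ^+ 2 * D n.+1 <= q n + L ^+ 2 / 2 * D n + S n.+1.
  move=> nM; have [k1 kh kt kL] := adm1 n (ltnW nM).
  have [k1' kh' kt' kL'] := adm1 n.+1 nM.
  have [k4 _ dk] := adm2 n nM.
  have [zn0 znN] := zb n (ltnW nM); have [zm0 zmN] := zb n.+1 nM.
  have := Hstep N h tau (kap n) (kap n.+1) chi (b n.+1) (z n) (z n.+1) h0 hN t0
    k1 k1' kh kh' kt kt' kL' k4 dk chiN zn0 znN zm0 zmN
    (fun i iN => HA n i nM iN) (fun i iN => zs n i nM iN) (w n) (w n.+1)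
    (fun i => erefl) (fun i => erefl).
  rewrite -/(q n) -/(q n.+1) -/(D n) -/(D n.+1) => H; apply: (le_trans H).
  rewrite lerD2l /S.
  have -> : 3 * cl * (tau * (expR (- (2 * kap n.+1 ^+ 2)) * T n.+1)) =
     3 * tau * (expR (- (2 * kap n.+1 ^+ 2)) * cl * T n.+1) by ring.
  rewrite ler_pM2l ?mulr_gt0 // /T mulr_sumr; apply: ler_sum => i _.
  have -> : (expR (kap n.+1 ^+ 2 * wt L h i.+1) * cut_comm chi (z n.+1) i / h ^+ 2) ^+ 2 =
     expR (kap n.+1 ^+ 2 * wt L h i.+1) ^+ 2 * (cut_comm chi (z n.+1) i ^+ 2 / h ^+ 4).
    by field.
  have -> : expR (kap n.+1 ^+ 2 * wt L h i.+1) ^+ 2 = expR (2 * (kap n.+1 ^+ 2 * wt L h i.+1)).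
    by rewrite [RHS]expR_half; congr (expR _ ^+ 2); field.
  rewrite -[leRHS]mulrA.
  apply: ler_pM; first exact: expR_ge0.
  - exact: divr_ge0 (sqr_ge0 _) (exprn_ge0 4 (ltW h0)).
  - rewrite ler_expR.
    have /andP[_ Bd] := wt_bounds L0 h0 hN (ltnW (ltn_ord i) : (i.+1 <= N.+1)%N).
    have := ler_wpM2l (sqr_ge0 (kap n.+1)) Bd; lra.
  rewrite ler_pdivrMr ?exprn_gt0 //.
  by have := src (z n.+1) i; rewrite /cut_comm; lra.
have H1 := sum_recursion (ltW L20) D0 rec.
have [kM1 khM _ _] := adm1 M (leqnn M).
have [k01 kh0 kt0 _] := adm1 0%N isT.
have wN n : (n <= M)%N -> w n N.+1 = 0.
  by move=> nM; have [_ zN] := zb n nM; rewrite /w zN !mulr0.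
have M0w := weighted_mass_le (w := w 0%N) L0 h0 hN (sqr_ge0 (kap 0%N)) chi1 (fun i => erefl).
have MMw := weighted_mass_le (w := w M) L0 h0 hN (sqr_ge0 (kap M)) chi1 (fun i => erefl).
have q0 : q 0%N <= (4 + 2 * c) * mass N (w 0%N) / h ^+ 2.
  rewrite ler_pM2r ?invr_gt0 //.
  have CB i : (i < N)%N -> 0 <= wcosh L h (kap 0%N ^+ 2) i.+1 <= 1 + c.
    move=> iN; have /andP[-> /= X] := wcosh_bounds L0 h0 hN (sqr_ge0 (kap 0%N)) kh0 iN.
    apply: (le_trans X); rewrite lerD2l ler_piMr ?(ltW c0) // exprn_ile1 //.
    by rewrite mulr_ge0 ?sqr_ge0 // ltW.
  have c1 : 0 <= 1 + c by lra.
  have := symm_form_le CB c1 (wN 0%N isT); rewrite /mass; lra.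
(* The form at the last level has no sign; its negative part joins the end errors. *)
have qM : - (2 * c * mass N (w M) / h ^+ 2) <= q M.
  rewrite -mulNr ler_pM2r ?invr_gt0 // -mulNr.
  have CB i : (i < N)%N -> 0 <= wcosh L h (kap M ^+ 2) i.+1 <= 1 + c.
    move=> iN; have /andP[-> /= X] := wcosh_bounds L0 h0 hN (sqr_ge0 (kap M)) khM iN.
    apply: (le_trans X); rewrite lerD2l ler_piMr ?(ltW c0) // exprn_ile1 //.
    by rewrite mulr_ge0 ?sqr_ge0 // ltW.
  exact: symm_form_ge CB (ltW c0) (wN M (leqnn M)).
have CA := caccioppoli h0 t0 A0 (ltW cl0) (ltW d0) M0
  (fun n nM => let: And4 k1 _ _ _ := adm1 n nM in k1)
  (fun n nM => let: And3 _ k4 _ := adm2 n nM in k4)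
  (fun n nM => let: And3 _ _ dk := adm2 n nM in dk) psi1 psiS dpsi dpsiS Hz HA.
rewrite -/B in CA.
set Obs := \sum_(n < M) tau * window_mass N h p (p + 10 * l) (z n.+1) in CA *.
have Obs0 : 0 <= Obs.
  by apply: sumr_ge0 => n _; rewrite mulr_ge0 ?window_mass_ge0 // ltW.
have SS : \sum_(n < M) S n.+1 <= 3 * cl * (expR (- (kap 0%N ^+ 2 / 2)) * mass N (z 0%N) + B * Obs).
  rewrite /S -mulr_sumr ler_wpM2l //; lra.
have lower : \sum_(n < M) tau * (expR (- (2 * (4 * L ^+ 2 + 1) * kap n.+1 ^+ 2)) *
     window_mass N h 0 (p + 4 * l) (z n.+1)) <= \sum_(n < M) D n.+1.
  apply: ler_sum => n _; have [k1 _ _ _] := adm1 n.+1 (ltn_ord n).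
  have X : expR (- (2 * (4 * L ^+ 2 + 1) * kap n.+1 ^+ 2)) *
     window_mass N h 0 (p + 4 * l) (z n.+1) <= mass N (w n.+1).
    rewrite /window_mass /mass mulr_sumr [leLHS]big_mkcond /=; apply: ler_sum => i _.
    case: ifP => [/andP[_ U]|_]; last exact: sqr_ge0.
    rewrite /w chiL // mul1r exprMn ler_wpM2r ?sqr_ge0 //.
    rewrite (expR_half (- _)) lerXn2r ?nnegrE ?expR_ge0 // ler_expR.
    have /andP[Bd _] := wt_bounds L0 h0 hN (ltnW (ltn_ord i) : (i.+1 <= N.+1)%N).
    have := ler_wpM2l (sqr_ge0 (kap n.+1)) Bd; lra.
  rewrite /D -[leRHS]mulrA ler_pM2l //; apply: (le_trans X).
  by rewrite ler_peMl ?mass_ge0 // expr_ge1 // (le_trans ler01).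
apply: (le_trans lower).
have e00 : 0 <= expR (- (kap 0%N ^+ 2 / 2)) * mass N (z 0%N).
  by rewrite mulr_ge0 ?expR_ge0 ?mass_ge0.
have eM0 : 0 <= expR (- (2 * kap M ^+ 2)) * mass N (z M).
  by rewrite mulr_ge0 ?expR_ge0 ?mass_ge0.
have M0w' : mass N (w 0%N) <= expR (- (kap 0%N ^+ 2 / 2)) * mass N (z 0%N).
  apply: (le_trans M0w); rewrite ler_wpM2r ?mass_ge0 // ler_expR.
  by have := sqr_ge0 (kap 0%N); lra.
set e1 := expR (- (kap 0%N ^+ 2 / 2)) * mass N (z 0%N) in CA SS M0w' e00 *.
set e2 := expR (- (2 * kap M ^+ 2)) * mass N (z M) in eM0 MMw *.
have hL : h ^+ 2 <= L ^+ 2.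
  rewrite lerXn2r ?nnegrE ?(ltW h0) ?(ltW L0) //; lra.
have eh : e1 <= L ^+ 2 * (e1 / h ^+ 2).
  by rewrite mulrA ler_pdivlMr // mulrC ler_wpM2r.
have D0e : D 0%N <= eta * e1.
  rewrite /D; apply: ler_pM => //; first exact: mass_ge0.
  by rewrite mulrC.
have X1 : (4 + 2 * c) * mass N (w 0%N) / h ^+ 2 <= (4 + 2 * c) * (e1 / h ^+ 2).
  by rewrite -mulrA ler_wpM2l ?ler_pM2r ?invr_gt0 //; lra.
have X2 : 2 * c * mass N (w M) / h ^+ 2 <= 2 * c * (e2 / h ^+ 2).
  by rewrite -mulrA ler_wpM2l ?ler_pM2r ?invr_gt0 //; lra.
have eh0 : 0 <= e1 / h ^+ 2 by rewrite divr_ge0 // ltW.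
have eMh0 : 0 <= e2 / h ^+ 2 by rewrite divr_ge0 // ltW.
have Y1 := ler_wpM2l (ltW L20) (le_trans D0e (ler_wpM2l (ltW e0) eh)).
have Y2 := ler_wpM2l (ltW cl0) eh.
rewrite /C mulrAC ler_pdivlMr // mulrDl.
have Z1 := mulr_ge0 (ltW clL) Obs0.
have Z2 := mulr_ge0 (ltW B20) Obs0.
have Z3 := mulr_ge0 (ltW c0) Obs0.
have Z4 := mulr_ge0 (ltW clB) eh0.
have Z5 := mulr_ge0 (ltW c0) eh0.
have Z6 := mulr_ge0 (ltW clB) eMh0.
have Z7 := mulr_ge0 (ltW clL) eMh0.
have Z8 := mulr_ge0 (ltW B20) eMh0.
rewrite /B2 in Z2 Z8 *.
lra.
Qed.

End LeftSideObservability.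

(** * The time weight and the growth of solutions *)

Section TimeWeight.
Variable R : realType.

Definition time_weight (eps rho T tau : R) (n : nat) : R :=
  (eps * Num.min (n%:R * tau) (T - n%:R * tau) + rho)^-1.

(** With [kap = 1 / r], the slope [eps] of [r] controls the variation, [r >= rho] bounds [kap] from
    above, and the smallness of [r] bounds it from below. The step condition gives
    [kap^6 tau <= T^-2 rho^2], which is small with [rho]. *)
Lemma admissible_time_weight (T delta Lam eta : R) :
  0 < T -> 0 < delta -> 0 < eta ->
  exists eps rho0 : R, [/\ 0 < eps, 0 < rho0 &
  forall M (h tau rho : R), (0 < M)%N -> 0 < tau -> M%:R * tau = T ->
    0 < rho <= rho0 -> h <= rho ^+ 2 -> tau <= T ^- 2 * rho ^+ 8 ->
    admissible_weight M h tau delta Lam eta (time_weight eps rho T tau)].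
Proof.
move=> T0 d0 e0.
pose L1 := Num.max 1 Lam.
have L11 : 1 <= L1 by rewrite le_max lexx.
have LL : Lam <= L1 by rewrite le_max lexx orbT.
have L10 : 0 < L1 by lra.
have T20 : 0 < T ^+ 2 by rewrite exprn_gt0.
(* [12 = 3 * 4]: [r_n + r_(n+1) <= 3 r_n] and [r_(n+1)^-2 <= 4 r_n^-2]. The second bound and the
   first one in [rho0] give [r <= 1 / L1], hence [Lam <= kap^6]. *)
pose eps := Num.min (delta / 12) (1 / (2 * T * L1)).
have eps0 : 0 < eps by rewrite lt_min !divr_gt0 // ?mulr_gt0.
have epsd : 12 * eps <= delta.
  have : eps <= delta / 12 by rewrite ge_min lexx.
  lra.
have epsT : eps * T * L1 <= 1 / 2.
  have : eps <= 1 / (2 * T * L1) by rewrite ge_min lexx orbT.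
  rewrite ler_pdivlMr ?mulr_gt0 //; lra.
(* The second entry yields [kap^6 tau <= eta]; the third yields [eps * tau <= rho], which makes
   consecutive values of [r] comparable. *)
pose rho0 := Num.min (1 / (2 * L1)) (Num.min (eta * T ^+ 2) (T ^+ 2 / eps)).
have rho00 : 0 < rho0 by rewrite !lt_min !divr_gt0 ?mulr_gt0.
exists eps, rho0; split=> // M h tau rho M0 t0 MT /andP[r0 rr] hr tr.
have r1 : rho * L1 <= 1 / 2.
  have : rho <= 1 / (2 * L1) by apply: (le_trans rr); rewrite ge_min lexx.
  rewrite ler_pdivlMr ?mulr_gt0 //; lra.
have r2 : rho <= eta * T ^+ 2.
  by apply: (le_trans rr); rewrite !ge_min lexx orbT.
have r3 : eps * rho <= T ^+ 2.
  have : rho <= T ^+ 2 / eps by apply: (le_trans rr); rewrite !ge_min lexx !orbT.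
  by rewrite ler_pdivlMr // mulrC.
have rho1 : rho <= 1.
  have := ler_wpM2l (ltW r0) L11; lra.
have tr' : tau * T ^+ 2 <= rho ^+ 8 by rewrite -ler_pdivlMr // mulrC.
pose m (n : nat) := Num.min (n%:R * tau) (T - n%:R * tau).
pose r n := eps * m n + rho.
have m0 n : (n <= M)%N -> 0 <= m n <= T.
  move=> nM; have H1 : 0 <= n%:R * tau by rewrite mulr_ge0 // ltW.
  have H2 : n%:R * tau <= T by rewrite -MT ler_pM2r // ler_nat.
  by rewrite le_min ge_min H1 H2 subr_ge0 H2.
have mS n : `|m n.+1 - m n| <= tau.
  have E : n.+1%:R * tau = n%:R * tau + tau by rewrite -addn1 natrD mulrDl mul1r.
  rewrite ler_norml /m E; move: (n%:R * tau) => t.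
  by rewrite /Num.min; case: ifP => ?; case: ifP => ?; apply/andP; split; lra.
have rg n : (n <= M)%N -> rho <= r n.
  by move=> nM; have /andP[H _] := m0 n nM; rewrite lerDr mulr_ge0 // ltW.
have rS n : `|r n.+1 - r n| <= eps * tau.
  have -> : r n.+1 - r n = eps * (m n.+1 - m n) by rewrite /r; ring.
  by rewrite normrM gtr0_norm // ler_pM2l.
have et : eps * tau <= rho.
  have X : eps * (tau * T ^+ 2) <= eps * rho ^+ 2.
    rewrite ler_pM2l //; apply: (le_trans tr').
    by rewrite ler_wiXn2l // ltW.
  have Y := ler_wpM2r (ltW r0) r3.
  by rewrite -(ler_pM2r T20); rewrite !expr2 in X Y *; lra.
have rL n : (n <= M)%N -> r n * L1 <= 1.
  move=> nM; have /andP[_ H] := m0 n nM.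
  have := ler_wpM2l (mulr_ge0 (ltW eps0) (ltW L10)) H.
  rewrite /r; lra.
have rpos n : (n <= M)%N -> 0 < r n by move=> nM; apply: lt_le_trans (rg n nM).
have rle1 n : (n <= M)%N -> r n <= 1.
  move=> nM; apply: le_trans (rL n nM); rewrite ler_peMr // ltW // rpos //.
have r2S n : (n < M)%N -> r n <= 2 * r n.+1 /\ r n.+1 <= 2 * r n.
  move=> nM; have := rS n; rewrite ler_norml => /andP[? ?].
  have := rg n (ltnW nM); have := rg n.+1 nM; lra.
have kE n : time_weight eps rho T tau n = (r n)^-1 by [].
split=> n nM; rewrite ?kE.
  have Rp := rpos n nM; have R1 := rle1 n nM.
  split.
  - by rewrite -[leLHS]invr1 lef_pV2 ?posrE.
  - rewrite exprVn mulrC ler_pdivrMr ?exprn_gt0 // mul1r (le_trans hr) //.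
    by rewrite lerXn2r ?nnegrE ?(ltW r0) ?(ltW Rp) // rg.
  - rewrite exprVn mulrC ler_pdivrMr ?exprn_gt0 //.
    have X : rho ^+ 6 <= r n ^+ 6 by rewrite lerXn2r ?nnegrE ?(ltW r0) ?(ltW Rp) // rg.
    apply: le_trans (ler_wpM2l (ltW e0) X).
    rewrite -(ler_pM2r T20); apply: (le_trans tr').
    have Y := ler_wpM2r (exprn_ge0 7 (ltW r0)) r2.
    have Z : rho ^+ 7 <= rho ^+ 6 by rewrite ler_wiXn2l // ltW.
    have W := ler_wpM2l (mulr_ge0 (ltW e0) (ltW T20)) Z.
    rewrite exprS; lra.
  rewrite exprVn (le_trans LL) // -div1r ler_pdivlMr ?exprn_gt0 //.
  apply: le_trans (rL n nM); rewrite mulrC ler_pM2r //.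
  have -> : r n ^+ 6 = r n ^+ 5 * r n by rewrite exprSr.
  by rewrite ler_piMl ?(ltW Rp) // exprn_ile1 // ltW.
have Rp := rpos n (ltnW nM); have Rp' := rpos n.+1 nM.
have [A1 A2] := r2S n nM.
have B1 : (r n) ^+ 2 <= 4 * (r n.+1) ^+ 2.
  have -> : 4 * r n.+1 ^+ 2 = (2 * r n.+1) ^+ 2 by rewrite exprMn; ring.
  by rewrite lerXn2r ?nnegrE ?mulr_ge0 ?(ltW Rp) ?(ltW Rp').
have B2 : (r n.+1) ^+ 2 <= 4 * (r n) ^+ 2.
  have -> : 4 * r n ^+ 2 = (2 * r n) ^+ 2 by rewrite exprMn; ring.
  by rewrite lerXn2r ?nnegrE ?mulr_ge0 ?(ltW Rp) ?(ltW Rp').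
have C1 : (r n.+1)^-1 ^+ 2 <= 4 * (r n)^-1 ^+ 2.
  by rewrite !exprVn ler_pdivlMr ?exprn_gt0 // mulrC ler_pdivrMr ?exprn_gt0.
have C2 : (r n)^-1 ^+ 2 <= 4 * (r n.+1)^-1 ^+ 2.
  by rewrite !exprVn ler_pdivlMr ?exprn_gt0 // mulrC ler_pdivrMr ?exprn_gt0.
split=> //.
have -> : (r n.+1)^-1 ^+ 2 - (r n)^-1 ^+ 2 =
   (r n - r n.+1) * (r n + r n.+1) * (r n)^-1 ^+ 2 * (r n.+1)^-1 ^+ 2.
  by field; rewrite !gt_eqF.
have s0 : 0 <= r n + r n.+1 by lra.
rewrite 3!normrM (ger0_norm s0) (ger0_norm (sqr_ge0 _)) (ger0_norm (sqr_ge0 _)).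
have D1 : `|r n - r n.+1| * (r n + r n.+1) <= (eps * tau) * (3 * r n).
  by apply: ler_pM => //; [rewrite distrC; exact: rS | lra].
have D2 := ler_wpM2r (sqr_ge0 (r n)^-1) D1.
have D3 : `|r n - r n.+1| * (r n + r n.+1) * (r n)^-1 ^+ 2 * (r n.+1)^-1 ^+ 2 <=
   (eps * tau) * (3 * r n) * (r n)^-1 ^+ 2 * (4 * (r n)^-1 ^+ 2).
  apply: ler_pM => //; rewrite ?sqr_ge0 //.
  exact: mulr_ge0 (mulr_ge0 (normr_ge0 _) s0) (sqr_ge0 _).
apply: (le_trans D3).
have -> : (eps * tau) * (3 * r n) * (r n)^-1 ^+ 2 * (4 * (r n)^-1 ^+ 2) =
   12 * eps * (tau * (r n)^-1 ^+ 3) by field; rewrite gt_eqF.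
rewrite -[leRHS]mulrA ler_wpM2r // mulr_ge0 ?(ltW t0) // exprn_ge0 // invr_ge0 ltW //.
Qed.

Lemma time_weight_ends (eps rho T tau : R) M : 0 <= T -> M%:R * tau = T ->
  time_weight eps rho T tau 0 = rho^-1 /\ time_weight eps rho T tau M = rho^-1.
Proof.
move=> T0 MT; rewrite /time_weight MT mul0r subr0 subrr !(min_l T0) (min_r T0).
by rewrite !mulr0 !add0r.
Qed.

(** The bound does not involve [rho]: in the middle of the time interval the Carleman weight costs a
    constant independent of the mesh. *)
Lemma time_weight_mid (eps rho T tau : R) n : 0 < eps -> 0 < rho -> 0 < T ->
  T / 4 <= n%:R * tau -> n%:R * tau <= 3 * T / 4 ->
  time_weight eps rho T tau n ^+ 2 <= (eps * (T / 4)) ^- 2.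
Proof.
move=> e0 r0 T0 H1 H2.
have H : eps * (T / 4) <= eps * Num.min (n%:R * tau) (T - n%:R * tau) + rho.
  have : eps * (T / 4) <= eps * Num.min (n%:R * tau) (T - n%:R * tau).
    by rewrite ler_pM2l // le_min H1 /=; lra.
  lra.
have H0 : 0 < eps * (T / 4) by rewrite mulr_gt0 // divr_gt0.
rewrite /time_weight exprVn lef_pV2 ?posrE ?exprn_gt0 //; last exact: lt_le_trans H.
by rewrite lerXn2r ?nnegrE ?(ltW H0) // (le_trans _ H) // ltW.
Qed.

(** The factor [1 / (1 - 2 A tau)] of one step is at most [1 + 4 A tau <= expR (4 A tau)] when
    [4 A tau <= 1]. *)
Lemma mass_growth N M (h tau A : R) (b z : nat -> nat -> R) n m :
  0 < h -> 0 < tau -> 0 <= A -> 4 * A * tau <= 1 -> adjoint_scheme N M h tau b z ->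
  (forall n i, (n < M)%N -> (i < N)%N -> `|b n.+1 i.+1| <= A) ->
  (n + m <= M)%N ->
  mass N (z (n + m)%N) <= expR (4 * A * (m%:R * tau)) * mass N (z n).
Proof.
move=> h0 t0 A0 At [zb zs] HA.
elim: m => [|m IH] nm; first by rewrite addn0 mul0r mulr0 expR0 mul1r.
rewrite addnS in nm *.
have [z0 zN] := zb _ nm.
have E := energy_step h0 t0 z0 zN (fun i iN => HA _ i nm iN) (fun i iN => zs _ i nm iN).
rewrite -/(mass N _) -/(mass N _) in E.
have {}IH := IH (ltnW nm).
have g1 : 1 + 4 * A * tau <= expR (4 * A * tau) := expR_ge1Dx _.
have a0 : 0 <= 4 * A * tau by rewrite mulr_ge0 ?mulr_ge0 // ltW.
have M0 := mass_ge0 N (z (n + m).+1).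
have X : mass N (z (n + m).+1) <= (1 + 4 * A * tau) * mass N (z (n + m)%N).
  have a1 : 0 <= 1 + 4 * A * tau by lra.
  have := ler_wpM2l a1 E.
  have : 0 <= (4 * A * tau) * (1 - 4 * A * tau) * mass N (z (n + m).+1).
    by apply: mulr_ge0 => //; apply: mulr_ge0 => //; lra.
  lra.
apply: (le_trans X).
have -> : expR (4 * A * (m.+1%:R * tau)) = expR (4 * A * tau) * expR (4 * A * (m%:R * tau)).
  by rewrite -expRD; congr expR; rewrite -addn1 natrD; ring.
rewrite -[leRHS]mulrA; apply: ler_pM => //; last exact: mass_ge0.
lra.
Qed.

End TimeWeight.

(** * Relaxed observability on the whole interval *)

Section Observability.
Variable R : realType.

Definition reflect N (z : nat -> R) (i : nat) : R := z (N.+1 - i)%N.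

Lemma sum_reflect N (P : pred nat) (F : nat -> R) :
  \sum_(i < N | P i.+1) F i.+1 = \sum_(i < N | P (N.+1 - i.+1)%N) F (N.+1 - i.+1)%N.
Proof.
rewrite (reindex_inj rev_ord_inj) /=.
by apply: eq_big => [i|i _]; rewrite /= subSS -subSn ?ltn_ord.
Qed.

Lemma mass_reflect N z : mass N (reflect N z) = mass N z.
Proof. by rewrite /mass /reflect [RHS](@sum_reflect N xpredT (fun i => z i ^+ 2)). Qed.

Lemma window_mass_reflect N (L h a b : R) z : N.+1%:R * h = L ->
  window_mass N h a b (reflect N z) = window_mass N h (L - b) (L - a) z.
Proof.
move=> hN; rewrite /window_mass /reflect
  [RHS](@sum_reflect N (fun i => L - b <= i%:R * h <= L - a) (fun i => z i ^+ 2)).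
apply: eq_bigl => i; rewrite natrB; last exact: ltnW (ltn_ord i).
rewrite mulrBl hN !lerD2l !lerN2.
by rewrite andbC.
Qed.

Lemma adjoint_scheme_reflect N M (h tau : R) b z : adjoint_scheme N M h tau b z ->
  adjoint_scheme N M h tau (fun n => reflect N (b n)) (fun n => reflect N (z n)).
Proof.
move=> [zb zs]; split=> [n nM|n i nM iN]; rewrite /reflect.
  by have [z0 zN] := zb n nM; rewrite subn0 subnn.
have H : (N - i.+1 < N)%N by rewrite ltn_subrL; case: N iN {zb zs}.
have := zs n (N - i.+1)%N nM H.
have -> : (N.+1 - i.+1)%N = (N - i.+1).+1 by rewrite subSS subnSK.
have -> : (N.+1 - i.+2)%N = (N - i.+1)%N by rewrite subSS.
have -> : (N.+1 - i)%N = (N - i.+1).+2 by rewrite subnSK // subSn // ltnW.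
by move=> ->; ring.
Qed.

Lemma pow8_expRN_le (x : R) : 0 <= x -> x ^+ 8 * expR (- x) <= 8 ^+ 8.
Proof.
move=> x0.
have H : 1 + x / 8 <= expR (x / 8) := expR_ge1Dx _.
have H2 : (x / 8) ^+ 8 <= expR x.
  have -> : expR x = expR (x / 8) ^+ 8.
    by rewrite -expRM_natl; congr expR; field.
  by rewrite lerXn2r ?nnegrE ?expR_ge0 ?divr_ge0 //; lra.
have := ler_wpM2r (expR_ge0 (- x)) H2; rewrite expR_mulN.
rewrite expr_div_n mulrAC ler_pdivrMr ?exprn_gt0 // mul1r.
by [].
Qed.

(** Used with [b = p + 4 l], [d = p + 6 l] and the window from [a = p] to [c = p + 10 l]: the gap
    between the left part and the reflected left part is observed directly. *)
Lemma mass_cover N (L h a b c d : R) z : 0 < h -> N.+1%:R * h = L ->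
  0 <= a -> a <= b -> d <= c -> d <= L ->
  mass N z <= window_mass N h 0 b z + window_mass N h a c z + window_mass N h d L z.
Proof.
move=> h0 hN a0 ab dc dL.
rewrite /window_mass /mass !(big_mkcond (fun i : 'I_N => _ <= _ <= _)) /= -!big_split /=.
apply: ler_sum => i _.
have x0 : 0 <= i.+1%:R * h by rewrite mulr_ge0 // ltW.
have xL : i.+1%:R * h <= L by rewrite -hN ler_pM2r // ler_nat ltnS ltnW.
have s := sqr_ge0 (z i.+1).
rewrite x0 xL andbT /=.
case: (lerP (i.+1%:R * h) b) => Hb; case: (lerP d (i.+1%:R * h)) => Hd /=;
  case: ifP => Hc; try lra.
Qed.

(** [y^4 <= h] turns [h^-2] into [y^-8]. Half of the exponent [y^-1 / 2] absorbs this power, by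
    [x^8 expR (- x) <= 8^8] at [x = y^-1 / 4]; the other half remains. *)
Lemma endpoint_error_le (gr h y z0 zM : R) : 0 < gr -> 0 < h -> 0 < y -> y ^+ 4 <= h ->
  0 <= z0 -> zM <= gr * z0 ->
  (expR (- (y^-1 / 2)) * z0 + expR (- (2 * y^-1)) * zM) / h ^+ 2
   <= (1 + gr) * (4 ^+ 8 * 8 ^+ 8) * (expR (- (1 / 4 / y)) * z0).
Proof.
move=> gr0 h0 yg yh z00 zMz.
have iy : 0 < y^-1 by rewrite invr_gt0.
have E1 : expR (- (2 * y^-1)) <= expR (- (y^-1 / 2)) by rewrite ler_expR; lra.
have E2 : expR (- (2 * y^-1)) * zM <= expR (- (y^-1 / 2)) * (gr * z0).
  apply: (le_trans (ler_wpM2l (expR_ge0 _) zMz)).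
  by rewrite ler_wpM2r // mulr_ge0 // ltW.
have h2 : (h ^+ 2)^-1 <= y^-1 ^+ 8.
  rewrite exprVn lef_pV2 ?posrE ?exprn_gt0 //.
  have -> : y ^+ 8 = (y ^+ 4) ^+ 2 by rewrite -exprM.
  by rewrite lerXn2r ?nnegrE ?exprn_ge0 ?(ltW yg) ?(ltW h0).
have S0 : 0 <= expR (- (y^-1 / 2)) * z0 + expR (- (y^-1 / 2)) * (gr * z0).
  by apply: addr_ge0; rewrite !mulr_ge0 ?expR_ge0 ?(ltW gr0).
have F1 : (expR (- (y^-1 / 2)) * z0 + expR (- (2 * y^-1)) * zM) / h ^+ 2 <=
   (expR (- (y^-1 / 2)) * z0 + expR (- (y^-1 / 2)) * (gr * z0)) * y^-1 ^+ 8.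
  apply: (@le_trans _ _ ((expR (- (y^-1 / 2)) * z0 + expR (- (y^-1 / 2)) * (gr * z0)) / h ^+ 2)).
    by rewrite ler_pM2r ?invr_gt0 ?exprn_gt0 // lerD2l.
  by rewrite ler_wpM2l.
apply: (le_trans F1).
have x0 : 0 <= y^-1 / 4 by rewrite divr_ge0 // ltW.
have P8 := pow8_expRN_le x0.
have E3 : expR (- (y^-1 / 2)) = expR (- (y^-1 / 4)) * expR (- (1 / 4 / y)).
  by rewrite -expRD; congr expR; field; rewrite gt_eqF.
have G0 : 0 <= 4 ^+ 8 * ((1 + gr) * (expR (- (1 / 4 / y)) * z0)).
  apply: mulr_ge0; first exact: exprn_ge0.
  by apply: mulr_ge0; [have := gr0; lra | rewrite mulr_ge0 ?expR_ge0].
have := ler_wpM2l G0 P8.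
rewrite E3 expr_div_n.
move: (expR (- (y^-1 / 4))) (expR (- (1 / 4 / y))) => ea eb Q.
apply: le_trans (_ : 4 ^+ 8 * ((1 + gr) * (eb * z0)) * 8 ^+ 8 <= _); last first.
  by rewrite le_eqVlt; apply/orP; left; apply/eqP; ring.
apply: le_trans Q.
by rewrite le_eqVlt; apply/orP; left; apply/eqP; field; rewrite gt_eqF.
Qed.

Lemma middle_sum_ge M (T tau c : R) (F : nat -> R) :
  0 < tau -> M%:R * tau = T -> tau <= T / 4 -> (forall n, 0 <= F n) -> 0 <= c ->
  (forall n, T / 4 <= n.+1%:R * tau -> n.+1%:R * tau <= T / 2 -> (n < M)%N -> c <= F n) ->
  T / 8 * c <= \sum_(n < M) tau * F n.
Proof.
move=> t0 MT tT F0 c0 H.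
(* For [n] from [q] to [2 q - 1], [n.+1] lies between [q + 1 >= M / 4] and [2 q <= M / 2]; since
   [M >= 4], these are at least [M / 8] indices. *)
pose q := (M %/ 4)%N.
have M4 : (4 <= M)%N.
  rewrite -(ler_nat R) -(ler_pM2r t0) MT; lra.
have q2 : (q + q <= M)%N by rewrite /q; lia.
have q8 : (M <= 8 * q)%N by rewrite /q; lia.
have q4 : (M <= 4 * q.+1)%N by rewrite /q; lia.
have q2' : (2 * (q + q) <= M)%N by rewrite /q; lia.
have qT : T / 8 <= q%:R * tau.
  rewrite -MT ler_pdivrMr // mulrAC ler_pM2r // -natrM ler_nat; lia.
apply: (le_trans (ler_wpM2r c0 qT)).
have G0 n : 0 <= tau * F n by rewrite mulr_ge0 // ltW.
rewrite -(big_mkord xpredT (fun n => tau * F n)) (@big_cat_nat _ _ _ q) //=; last by rewrite /q; lia.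
rewrite (@big_cat_nat _ _ _ (q + q)%N q) //=; last exact: leq_addr.
have S1 : 0 <= \sum_(0 <= i < q) tau * F i by apply: sumr_ge0.
have S3 : 0 <= \sum_(q + q <= i < M) tau * F i by apply: sumr_ge0.
suff : q%:R * tau * c <= \sum_(q <= i < q + q) tau * F i by lra.
have -> : q%:R * tau * c = \sum_(q <= i < q + q) tau * c.
  by rewrite sumr_const_nat addnK -mulrA mulr_natl.
apply: ler_sum_nat => n /andP[n1 n2]; rewrite ler_pM2l //.
apply: H; last exact: leq_trans q2.
  rewrite -MT -[leLHS]mulrC mulrA ler_pM2r // mulrC ler_pdivrMr // -natrM ler_nat.
  by lia.
rewrite -MT -[leRHS]mulrC mulrA ler_pM2r // mulrC ler_pdivlMr // -natrM ler_nat.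
by lia.
Qed.

Lemma observability (L T A p l : R) : 0 < L -> 0 < T -> 0 <= A ->
  0 <= p -> 0 < l -> p + 10 * l <= L ->
  exists y0 C : R, [/\ 0 < y0, 0 < C &
  forall N M (h tau y : R) (b z : nat -> nat -> R),
  (0 < M)%N -> 0 < h -> N.+1%:R * h = L -> 0 < tau -> M%:R * tau = T ->
  0 < y <= y0 -> h <= y -> y ^+ 4 <= h -> tau <= T ^- 2 * y ^+ 4 ->
  adjoint_scheme N M h tau b z ->
  (forall n i, (n < M)%N -> (i < N)%N -> `|b n.+1 i.+1| <= A) ->
  mass N (z M) <= C * (\sum_(n < M) tau * window_mass N h p (p + 10 * l) (z n.+1)
     + expR (- (1 / 4 / y)) * mass N (z 0%N))].
Proof.
move=> L0 T0 A0 p0 l0 pl.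
have [delta [Lam [eta [d0 e0 Hleft]]]] := left_observability L0 A0.
have [C1 [C10 H1]] := Hleft p l p0 l0 pl.
have p'0 : 0 <= L - p - 10 * l by lra.
have pl' : L - p - 10 * l + 10 * l <= L by lra.
have [C2 [C20 H2]] := Hleft (L - p - 10 * l) l p'0 l0 pl'.
have [eps [rho0 [eps0 rho00 Hadm]]] := @admissible_time_weight R T delta Lam eta T0 d0 e0.
have T20 : 0 < T ^+ 2 by rewrite exprn_gt0.
pose K := 4 * L ^+ 2 + 1.
have K0 : 0 < K by rewrite /K; have := sqr_ge0 L; lra.
(* In order: [y <= 1]; [rho <= rho0]; [h <= l]; [tau <= T / 4]; [4 A tau <= 1]. *)
pose y0 := Num.min (Num.min 1 (rho0 ^+ 2)) (Num.min l (Num.min (T ^+ 3 / 4) (T ^+ 2 / (4 * A + 1)))).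
have A1 : 0 < 4 * A + 1 by lra.
have y00 : 0 < y0 by rewrite !lt_min ltr01 l0 !exprn_gt0 ?divr_gt0 ?exprn_gt0.
pose cmid := expR (- (2 * K * (eps * (T / 4)) ^- 2)).
have cmid0 : 0 < cmid by apply: expR_gt0.
pose gr := expR (4 * A * T).
have gr0 : 0 < gr by apply: expR_gt0.
pose Cerr := (1 + gr) * (4 ^+ 8 * 8 ^+ 8).
have Cerr0 : 0 < Cerr by rewrite !mulr_gt0 ?exprn_gt0 //; lra.
pose C3 := (C1 + C2 + 1) + (C1 + C2) * Cerr.
have C30 : 0 < C3.
  by rewrite /C3; have : 0 < (C1 + C2) * Cerr; [rewrite mulr_gt0 // addr_gt0 | lra].
exists y0, (C3 * (8 / T * gr / cmid)).
split=> //; first by rewrite !mulr_gt0 ?invr_gt0.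
move=> N M h tau y b z M0 h0 hN t0 MT /andP[yg yy] hy yh ty Hz HA.
have y1 : y <= 1 by apply: (le_trans yy); rewrite !ge_min lexx.
have yrho : y <= rho0 ^+ 2 by apply: (le_trans yy); rewrite !ge_min lexx orbT.
have yl : y <= l by apply: (le_trans yy); rewrite !ge_min lexx !orbT.
have yT : y <= T ^+ 3 / 4 by apply: (le_trans yy); rewrite !ge_min lexx !orbT.
have yA : y * (4 * A + 1) <= T ^+ 2.
  have : y <= T ^+ 2 / (4 * A + 1) by apply: (le_trans yy); rewrite !ge_min lexx !orbT.
  by rewrite ler_pdivlMr.
have y4 : y ^+ 4 <= y by rewrite -[leRHS]expr1 ler_wiXn2l // ltW.
have tT2 : tau * T ^+ 2 <= y.
  by apply: le_trans y4; rewrite -ler_pdivlMr // mulrC.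
have tA : 4 * A * tau <= 1.
  have X : tau * T ^+ 2 * (4 * A + 1) <= 1 * T ^+ 2.
    rewrite mul1r; apply: le_trans yA.
    by rewrite ler_pM2r.
  by rewrite mulrAC ler_pM2r // in X; clear -X t0; lra.
have tT : tau <= T / 4.
  have X : tau * T ^+ 2 <= (T / 4) * T ^+ 2.
    by apply: (le_trans (le_trans tT2 yT)); rewrite le_eqVlt; apply/orP; left; apply/eqP; field.
  by rewrite ler_pM2r in X.
(* Then [kap^2] is [1 / y] at both ends, and [rho^8 = y^4] matches the bound on the time step. *)
pose rho := Num.sqrt y.
have rho_gt0 : 0 < rho by rewrite sqrtr_gt0.
have rho2 : rho ^+ 2 = y by rewrite sqr_sqrtr // ltW.
have rho8 : rho ^+ 8 = y ^+ 4 by rewrite -rho2 -exprM.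
have rhole : rho <= rho0.
  by rewrite -(@ler_pXn2r _ 2) ?nnegrE ?(ltW rho_gt0) ?(ltW rho00) // rho2.
pose kap := time_weight eps rho T tau.
have adm : admissible_weight M h tau delta Lam eta kap.
  by apply: Hadm; rewrite ?rho2 ?rho8 // rho_gt0.
have hl : h <= l by apply: le_trans yl.
have L1 := H1 N M h tau kap b z h0 hl hN t0 M0 adm Hz HA.
clear H1 Hleft Hadm.
have HA' : forall n i, (n < M)%N -> (i < N)%N -> `|reflect N (b n.+1) i.+1| <= A.
  move=> n i nM iN; rewrite /reflect.
  have -> : (N.+1 - i.+1)%N = (N - i.+1).+1 by rewrite subSS subnSK.
  by apply: HA => //; rewrite ltn_subrL; case: (N) iN.
have {H2}L2 := H2 N M h tau kap _ _ h0 hl hN t0 M0 adm (adjoint_scheme_reflect Hz) HA'.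
rewrite -/K in L1 L2.
have [kap0 kapM] := time_weight_ends eps rho (ltW T0) MT.
rewrite -/kap in kap0 kapM.
have grow n m : (n + m <= M)%N -> mass N (z (n + m)%N) <= gr * mass N (z n).
  move=> nm; apply: (le_trans (mass_growth h0 t0 A0 tA Hz HA nm)).
  rewrite ler_wpM2r ?mass_ge0 // ler_expR ler_wpM2l ?mulr_ge0 //.
  by rewrite -MT ler_pM2r // ler_nat (leq_trans _ nm) // leq_addl.
have grM : mass N (z M) <= gr * mass N (z 0%N) by have := @grow 0%N M (leqnn _).
have Er : (expR (- (kap 0%N ^+ 2 / 2)) * mass N (z 0%N) +
    expR (- (2 * kap M ^+ 2)) * mass N (z M)) / h ^+ 2 <=
    Cerr * (expR (- (1 / 4 / y)) * mass N (z 0%N)).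
  rewrite kap0 kapM exprVn rho2.
  exact: endpoint_error_le (mass_ge0 _ _) grM.
set Obs := \sum_(n < M) tau * window_mass N h p (p + 10 * l) (z n.+1) in L1 *.
have OO : \sum_(n < M) tau * window_mass N h (L - p - 10 * l) (L - p - 10 * l + 10 * l)
   (reflect N (z n.+1)) = Obs.
  apply: eq_bigr => n _; rewrite (window_mass_reflect _ _ _ hN).
  by congr (_ * window_mass _ _ _ _ _); clear; lra.
rewrite OO !mass_reflect in L2.
set X0 := expR (- (1 / 4 / y)) * mass N (z 0%N) in Er *.
have X00 : 0 <= X0 by rewrite mulr_ge0 ?expR_ge0 ?mass_ge0.
have Obs0 : 0 <= Obs.
  by apply: sumr_ge0 => n _; rewrite mulr_ge0 ?window_mass_ge0 // ltW.
have total : \sum_(n < M) tau * (expR (- (2 * K * kap n.+1 ^+ 2)) * mass N (z n.+1))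
   <= C3 * (Obs + X0).
  suff : \sum_(n < M) tau * (expR (- (2 * K * kap n.+1 ^+ 2)) * mass N (z n.+1)) <=
    \sum_(n < M) tau * (expR (- (2 * K * kap n.+1 ^+ 2)) * window_mass N h 0 (p + 4 * l) (z n.+1))
    + Obs +
    \sum_(n < M) tau * (expR (- (2 * K * kap n.+1 ^+ 2)) *
      window_mass N h 0 (L - p - 10 * l + 4 * l) (reflect N (z n.+1))).
    move: L1 L2 Er; set s1 := \sum_(n < M) _; set s2 := \sum_(n < M) _; set s3 := \sum_(n < M) _.
    set E := _ / h ^+ 2 => L1 L2 Er S.
    have Y1 := ler_wpM2l (ltW C10) Er; have Y2 := ler_wpM2l (ltW C20) Er.
    have C12 := mulr_gt0 C10 Cerr0; have C22 := mulr_gt0 C20 Cerr0.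
    have Z1 := mulr_ge0 (ltW C12) Obs0; have Z2 := mulr_ge0 (ltW C22) Obs0.
    have Z3 := mulr_ge0 (ltW C10) X00; have Z4 := mulr_ge0 (ltW C20) X00.
    rewrite /C3; clear -L1 L2 S Y1 Y2 Z1 Z2 Z3 Z4 X00 Obs0; lra.
  rewrite /Obs -!big_split /=; apply: ler_sum => n _.
  rewrite -!mulrDr ler_pM2l // (window_mass_reflect _ _ _ hN).
  have e1 : expR (- (2 * K * kap n.+1 ^+ 2)) <= 1.
    by rewrite -expR0 ler_expR oppr_le0 mulr_ge0 ?sqr_ge0 // mulr_ge0 // ltW.
  have Q1 := ler_wpM2r (window_mass_ge0 N h p (p + 10 * l) (z n.+1)) e1.
  have p4 : p <= p + 4 * l by clear -l0; lra.
  have p10 : p + 6 * l <= p + 10 * l by clear -l0; lra.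
  have p6 : p + 6 * l <= L by clear -l0 pl; lra.
  have Q2 := ler_wpM2l (expR_ge0 (- (2 * K * kap n.+1 ^+ 2))) (mass_cover (z n.+1) h0 hN p0 p4 p10 p6).
  have -> : L - (L - p - 10 * l + 4 * l) = p + 6 * l by ring.
  rewrite subr0; clear -Q1 Q2; lra.
have U : 0 <= cmid * (mass N (z M) / gr).
  by rewrite mulr_ge0 ?divr_ge0 ?mass_ge0 ?(ltW cmid0) ?(ltW gr0).
(* Only times in [[T/4, T/2]] are kept: the weight there is at least [cmid], and the growth estimate
   bounds the mass below by [mass N (z M) / gr]. *)
have W : T / 8 * (cmid * (mass N (z M) / gr)) <= C3 * (Obs + X0).
  apply: le_trans total.
  apply: (middle_sum_ge (F := fun n => expR (- (2 * K * kap n.+1 ^+ 2)) * mass N (z n.+1)) t0 MT tT) => // n.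
    by rewrite mulr_ge0 ?expR_ge0 ?mass_ge0.
  move=> n4 n2 nM; apply: ler_pM; first exact: ltW.
  - by rewrite divr_ge0 ?mass_ge0 // ltW.
  - rewrite ler_expR lerN2 ler_wpM2l ?mulr_ge0 ?(ltW K0) //.
    apply: time_weight_mid => //; apply: (le_trans n2); clear -T0; lra.
  - rewrite ler_pdivrMr // mulrC.
    have := @grow n.+1 (M - n.+1)%N; rewrite subnKC //; apply; exact: leqnn.
have -> : C3 * (8 / T * gr / cmid) * (Obs + X0) = C3 * (Obs + X0) * (8 / T * gr / cmid) by ring.
have Z0 : 0 <= 8 / T * gr / cmid by rewrite !mulr_ge0 ?invr_ge0 ?(ltW T0) ?(ltW gr0) ?(ltW cmid0).
apply: le_trans (ler_wpM2r Z0 W).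
by rewrite le_eqVlt; apply/orP; left; apply/eqP; field; rewrite !gt_eqF.
Qed.

End Observability.

(** * Solvability, duality and the penalized control *)

Section Control.
Variable R : realType.
Implicit Types (u v w z g : nat -> R).

Lemma linear_inj_surj n (f : 'rV[R]_n -> 'rV[R]_n) :
  (forall a (x y : 'rV[R]_n), f (a *: x + y) = a *: f x + f y) ->
  (forall x : 'rV[R]_n, f x = 0 -> x = 0) -> forall y, exists x, f x = y.
Proof.
move=> flin finj y.
pose F : {linear 'rV[R]_n -> 'rV[R]_n} :=
  HB.pack f (GRing.isLinear.Build R 'rV[R]_n 'rV[R]_n *:%R f flin).
have FE (x : 'rV[R]_n) : x *m lin1_mx F = f x by rewrite mul_rV_lin1.
have U : lin1_mx F \in unitmx.
  rewrite -row_free_unit -kermx_eq0; apply/eqP/row_matrixP => i; rewrite row0.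
  by apply: finj; rewrite -FE -row_mul mulmx_ker row0.
by exists (y *m invmx (lin1_mx F)); rewrite -FE mulmxKV.
Qed.

(** A canonical representative of a grid function: with the values outside [1..N] fixed to zero,
    equality on the grid is equality of functions. *)
Definition interior N u := u 0%N = 0 /\ forall i, (N < i)%N -> u i = 0.

Lemma interior_eq N u v : interior N u -> interior N v ->
  (forall i, (i < N)%N -> u i.+1 = v i.+1) -> u = v.
Proof.
move=> [u0 uN] [v0 vN] H; apply: funext => -[|i]; first by rewrite u0 v0.
case: (ltnP i N) => iN; first exact: H.
by rewrite uN ?vN.
Qed.

Lemma mass_eq0 N u : mass N u <= 0 -> forall i, (i < N)%N -> u i.+1 = 0.
Proof.
move=> H i iN; have /eqP : mass N u = 0 by apply/eqP; rewrite eq_le H mass_ge0.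
rewrite psumr_eq0 => [/allP /(_ (Ordinal iN) (mem_index_enum _))|j _]; last exact: sqr_ge0.
by rewrite sqrf_eq0 => /eqP.
Qed.

Definition of_row N (x : 'rV[R]_N) (j : nat) : R :=
  if j is i.+1 then (if insub i is Some k then x 0 k else 0) else 0.

Lemma of_rowE N (x : 'rV[R]_N) (k : 'I_N) : of_row x k.+1 = x 0 k.
Proof. by rewrite /of_row valK. Qed.

Lemma interior_of_row N (x : 'rV[R]_N) : interior N (of_row x).
Proof. by split=> // -[|i] // iN; rewrite /of_row insubN // -leqNgt. Qed.

(** Injectivity is phrased as [mass N u <= 0], the form in which energy and duality arguments
    deliver it. It serves both for the implicit step and for the penalized control operator. *)
Lemma grid_operator_surj N (F : (nat -> R) -> nat -> R) :
  (forall (a : R) u v i, F (fun j => a * u j + v j) i = a * F u i + F v i) ->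
  (forall u, interior N u -> (forall i, (i < N)%N -> F u i.+1 = 0) -> mass N u <= 0) ->
  forall w, exists u, interior N u /\ forall i, (i < N)%N -> F u i.+1 = w i.+1.
Proof.
move=> Flin Finj w.
pose f (x : 'rV[R]_N) : 'rV[R]_N := \row_k F (of_row x) k.+1.
have flin (a : R) (x y : 'rV[R]_N) : f (a *: x + y) = a *: f x + f y.
  apply/rowP => k; rewrite !mxE -Flin; congr (F _ _); apply: funext => -[|i] /=.
    by rewrite mulr0 addr0.
  by case: insub => [j|]; rewrite ?mxE // mulr0 addr0.
have finj (x : 'rV[R]_N) : f x = 0 -> x = 0.
  move=> fx; apply/rowP => k; rewrite mxE -of_rowE.
  apply: (@mass_eq0 N) => //; apply: Finj; first exact: interior_of_row.
  by move=> i iN; move/rowP: fx => /(_ (Ordinal iN)); rewrite !mxE.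
have [x fx] := linear_inj_surj flin finj (\row_k w k.+1).
exists (of_row x); split=> [|i iN]; first exact: interior_of_row.
by move/rowP: fx => /(_ (Ordinal iN)); rewrite !mxE.
Qed.

Definition implicit_step N (h tau : R) (b src zo z : nat -> R) : Prop :=
  forall i, (i < N)%N -> z i.+1 - zo i.+1 =
    tau * ((z i.+2 - 2 * z i.+1 + z i) / h ^+ 2 - b i.+1 * z i.+1) + src i.+1.

Lemma resolvent N (h tau A : R) : 0 < h -> 0 < tau -> 2 * A * tau < 1 ->
  exists G : (nat -> R) -> (nat -> R) -> nat -> R,
  forall b, (forall i, (i < N)%N -> `|b i.+1| <= A) ->
  forall w, interior N (G b w) /\ implicit_step N h tau b (fun=> 0) w (G b w).
Proof.
move=> h0 t0 At.
suff H b w : exists u, (forall i, (i < N)%N -> `|b i.+1| <= A) ->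
   interior N u /\ implicit_step N h tau b (fun=> 0) w u.
  exists (fun b => projT1 (choice (H b))) => b Hb w.
  exact: (projT2 (choice (H b))) w Hb.
(* Zero is a dummy value for unbounded [b]; it lets the choice be made for every [b] and [w]. *)
case: (pselect (forall i, (i < N)%N -> `|b i.+1| <= A)) => Hb; last by exists (fun=> 0).
pose F u i := u i - tau * ((u i.+1 - 2 * u i + u i.-1) / h ^+ 2 - b i * u i).
have [||u [u0 Hu]] := @grid_operator_surj N F _ _ w.
- by move=> a u v i; rewrite /F; ring.
- move=> u [u0 uN] Fu.
  have := @energy_step _ N h tau A b u (fun=> 0) h0 t0 u0 (uN _ (ltnSn N)) Hb.
  rewrite [X in _ <= X]big1 => [|i _]; last by rewrite expr0n.
  rewrite -/(mass N u) => E.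
  rewrite -(pmulr_rle0 _ (_ : 0 < 1 - 2 * A * tau)); last by rewrite subr_gt0.
  apply: E => i iN; rewrite subr0; have := Fu i iN; rewrite /F /=.
  by move/eqP; rewrite subr_eq0 => /eqP.
exists u => _; split=> // i iN; rewrite addr0 -(Hu i iN) /F /=; ring.
Qed.

Lemma implicit_step_unique N (h tau A : R) b src zo zo' z z' :
  0 < h -> 0 < tau -> 2 * A * tau < 1 -> (forall i, (i < N)%N -> `|b i.+1| <= A) ->
  z 0%N = 0 -> z' 0%N = 0 -> z N.+1 = 0 -> z' N.+1 = 0 ->
  (forall i, (i < N)%N -> zo i.+1 = zo' i.+1) ->
  implicit_step N h tau b src zo z -> implicit_step N h tau b src zo' z' ->
  forall i, (i < N)%N -> z i.+1 = z' i.+1.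
Proof.
move=> h0 t0 At Hb z0 z'0 zN z'N Hzo Hz Hz' i iN.
apply/eqP; rewrite -subr_eq0; apply/eqP.
apply: (@mass_eq0 N (fun j => z j - z' j)) iN.
have := @energy_step _ N h tau A b (fun j => z j - z' j) (fun=> 0) h0 t0 _ _ Hb.
rewrite /= z0 z'0 zN z'N subrr => /(_ erefl erefl) E.
rewrite -(pmulr_rle0 _ (_ : 0 < 1 - 2 * A * tau)); last by rewrite subr_gt0.
have -> : 0 = \sum_(j < N) 0 ^+ 2 :> R by rewrite big1 // => j _; rewrite expr0n.
apply: E => j jN; have := Hz j jN; have := Hz' j jN; rewrite (Hzo j jN).
move=> E1 E2.
have -> : z j.+1 - z' j.+1 - 0 = (z j.+1 - zo' j.+1) - (z' j.+1 - zo' j.+1) by ring.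
by rewrite E1 E2; ring.
Qed.

Definition forward N M (h tau : R) (a src : nat -> nat -> R) (y : nat -> nat -> R) g : Prop :=
  (forall i, (i < N)%N -> y 0%N i.+1 = g i.+1) /\
  forall n, (n < M)%N -> [/\ y n.+1 0%N = 0, y n.+1 N.+1 = 0 &
     implicit_step N h tau (a n.+1) (src n) (y n) (y n.+1)].

Lemma forward_unique N M (h tau A : R) a src y y' g :
  0 < h -> 0 < tau -> 2 * A * tau < 1 ->
  (forall n i, (n < M)%N -> (i < N)%N -> `|a n.+1 i.+1| <= A) ->
  forward N M h tau a src y g -> forward N M h tau a src y' g ->
  forall n i, (n <= M)%N -> (i < N)%N -> y n i.+1 = y' n i.+1.
Proof.
move=> h0 t0 At Ha [y0 Hy] [y'0 Hy']; elim=> [|n IH] i nM iN.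
  by rewrite y0 // y'0.
have [a1 a2 a3] := Hy n nM; have [b1 b2 b3] := Hy' n nM.
apply: (implicit_step_unique h0 t0 At (fun i iN => Ha n i nM iN) a1 b1 a2 b2 _ a3 b3) => //.
by move=> j jN; apply: IH => //; apply: ltnW.
Qed.

(** A solution operator linear in source and datum at every index, boundary included; this makes the
    control operator a linear map. *)
Lemma forward_flow N M (h tau A : R) a :
  0 < h -> 0 < tau -> 2 * A * tau < 1 ->
  (forall n i, (n < M)%N -> (i < N)%N -> `|a n.+1 i.+1| <= A) ->
  exists Y : (nat -> nat -> R) -> (nat -> R) -> nat -> nat -> R,
   (forall src g, Y src g 0%N = g) /\
   (forall src g, forward N M h tau a src (Y src g) g) /\
   (forall (c : R) src src' g g' n i, (n <= M)%N ->
      Y (fun n i => c * src n i + src' n i) (fun i => c * g i + g' i) n i =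
      c * Y src g n i + Y src' g' n i).
Proof.
move=> h0 t0 At Ha.
have [G HG] := resolvent N h0 t0 At.
pose Y src g := fix Y n := if n is m.+1 then G (a m.+1) (fun i => Y m i + src m i) else g.
exists Y; split=> //; split=> [src g|c src src' g g' n i nM].
  split=> // n nM; have [[I0 IN] E] := HG (a n.+1) (fun i iN => Ha n i nM iN) (fun i => Y src g n i + src n i).
  split=> //=; first exact: IN.
  move=> i iN; have := E i iN; rewrite addr0 => <-; ring.
elim: n i nM => [|n IH] i nM //=.
have Hb i0 iN := Ha n i0 nM iN.
set w1 := fun i => Y _ _ n i + _; set w2 := fun i => Y src g n i + _; set w3 := fun i => Y src' g' n i + _.
have [I1 E1] := HG _ Hb w1; have [I2 E2] := HG _ Hb w2; have [I3 E3] := HG _ Hb w3.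
have I4 : interior N (fun i => c * G (a n.+1) w2 i + G (a n.+1) w3 i).
  case: I2 I3 => [I20 I2N] [I30 I3N]; split; first by rewrite I20 I30 mulr0 addr0.
  by move=> j jN; rewrite I2N // I3N // mulr0 addr0.
suff -> : G (a n.+1) w1 = fun i => c * G (a n.+1) w2 i + G (a n.+1) w3 i by [].
apply: (interior_eq I1 I4).
have w123 j : w1 j = c * w2 j + w3 j by rewrite /w1 IH ?(ltnW nM) // /w2 /w3; ring.
have E4 : implicit_step N h tau (a n.+1) (fun=> 0) w1 (fun i => c * G (a n.+1) w2 i + G (a n.+1) w3 i).
  move=> j jN; have := E2 j jN; have := E3 j jN; rewrite w123 !addr0.
  move: (G _ w2) (G _ w3) => u2 u3 e3 e2.
  have -> : c * u2 j.+1 + u3 j.+1 - (c * w2 j.+1 + w3 j.+1) =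
    c * (u2 j.+1 - w2 j.+1) + (u3 j.+1 - w3 j.+1) by ring.
  by rewrite e2 e3; ring.
case: I1 I4 => [? ?] [? ?].
by apply: (implicit_step_unique h0 t0 At Hb _ _ _ _ _ E1 E4) => //; auto.
Qed.

Lemma duality_step N (h tau : R) b src y y' z z' :
  y' 0%N = 0 -> z' 0%N = 0 -> y' N.+1 = 0 -> z' N.+1 = 0 ->
  implicit_step N h tau b src y y' -> implicit_step N h tau b (fun=> 0) z z' ->
  \sum_(i < N) y' i.+1 * z i.+1 =
  \sum_(i < N) y i.+1 * z' i.+1 + \sum_(i < N) src i.+1 * z' i.+1.
Proof.
move=> y0 z0 yN zN Hy Hz.
apply/eqP; rewrite -subr_eq0 -big_split -sumrB /=.
pose Gi i := tau / h ^+ 2 * (y' i.+1 * z' i - y' i * z' i.+1).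
rewrite (eq_bigr (fun i : 'I_N => Gi i.+1 - Gi i)).
  by rewrite sum_telescope /Gi y0 z0 yN zN !mulr0 !mul0r subrr.
move=> i _; have := Hy i (ltn_ord i); have := Hz i (ltn_ord i).
rewrite addr0 => E1 E2.
have -> : y' i.+1 * z i.+1 - (y i.+1 * z' i.+1 + src i.+1 * z' i.+1) =
  (y' i.+1 - y i.+1) * z' i.+1 - y' i.+1 * (z' i.+1 - z i.+1) - src i.+1 * z' i.+1 by ring.
by rewrite E1 E2 /Gi; ring.
Qed.

(** The pairing of [y m] with [z (M - m)] changes only by the source. The index [M.+1 - n] makes the
    step of [z] from [M - m.+1] to [M - m] use [a m.+1], as does the step of [y] from [m] to
    [m.+1]. *)
Lemma duality N M (h tau : R) a src y (z : nat -> nat -> R) g :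
  forward N M h tau a src y g -> adjoint_scheme N M h tau (fun n => a (M.+1 - n)%N) z ->
  \sum_(i < N) y M i.+1 * z 0%N i.+1 =
  \sum_(i < N) g i.+1 * z M i.+1 + \sum_(n < M) \sum_(i < N) src n i.+1 * z (M - n)%N i.+1.
Proof.
move=> [y0 Hy] [zb zs].
suff H m : (m <= M)%N -> \sum_(i < N) y m i.+1 * z (M - m)%N i.+1 =
  \sum_(i < N) g i.+1 * z M i.+1 + \sum_(n < m) \sum_(i < N) src n i.+1 * z (M - n)%N i.+1.
  by have := H M (leqnn M); rewrite subnn.
elim: m => [|m IH] mM.
  by rewrite big_ord0 addr0 subn0; apply: eq_bigr => i _; rewrite y0.
rewrite big_ord_recr /= addrA -(IH (ltnW mM)).
have [a1 a2 a3] := Hy m mM.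
have mm : (M - m)%N = (M - m.+1).+1 by rewrite subnSK.
have [b1 b2] := zb (M - m)%N (leq_subr _ _).
apply: duality_step a3 _ => // i iN.
rewrite addr0 mm zs //; last by rewrite ltn_subrL /=; case: (M) mM.
by have -> : (M.+1 - (M - m.+1).+1)%N = m.+1 by rewrite subSS subKn.
Qed.

Lemma sum_rev M (F : nat -> R) : \sum_(n < M) F (M - n)%N = \sum_(n < M) F n.+1.
Proof.
rewrite (reindex_inj rev_ord_inj) /=; apply: eq_bigr => n _.
by rewrite subKn.
Qed.

(* Penalized Hilbert uniqueness method: the control is the adjoint trajectory
   issued from the [u] solving [y^M + phi u = 0]. *)
Lemma control_of_observability N M (h tau A phi C : R) (P : pred nat) a :
  0 < h -> 0 < tau -> 2 * A * tau < 1 -> 0 < phi -> 0 < C ->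
  (forall n i, (n < M)%N -> (i < N)%N -> `|a n.+1 i.+1| <= A) ->
  (forall z : nat -> nat -> R, adjoint_scheme N M h tau (fun n => a (M.+1 - n)%N) z ->
    mass N (z M) <= C * (tau * (\sum_(n < M) \sum_(i < N | P i.+1) z n.+1 i.+1 ^+ 2)
       + phi * mass N (z 0%N))) ->
  forall g, exists v : nat -> nat -> R,
   let src := fun n i => tau * (if P i then v n i else 0) in
   [/\ tau * (\sum_(n < M) \sum_(i < N | P i.+1) v n i.+1 ^+ 2) <= C * mass N g,
      (exists y, forward N M h tau a src y g) &
      (forall y, forward N M h tau a src y g -> mass N (y M) <= C * phi * mass N g)].
Proof.
move=> h0 t0 At phi0 C0 Ha Hobs g.
have Hb n i : (n < M)%N -> (i < N)%N -> `|a (M.+1 - n.+1)%N i.+1| <= A.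
  by move=> nM iN; rewrite subSS -subnSK //; apply: Ha => //; rewrite ltn_subrL; case: (M) nM.
have [Y [Y0 [YF Ylin]]] := forward_flow h0 t0 At Ha.
have [Z [Z0 [ZF Zlin]]] := @forward_flow N M h tau A (fun n => a (M.+1 - n)%N) h0 t0 At Hb.
pose zero : nat -> nat -> R := fun _ _ => 0.
pose z u := Z zero u.
pose ctl u n i := tau * (if P i then z u (M - n)%N i else 0).
have zadj u : interior N u -> adjoint_scheme N M h tau (fun n => a (M.+1 - n)%N) (z u).
  move=> [u0 uN]; have [_ Hz] := ZF zero u; split=> [[|n] nM|n i nM iN].
  - by rewrite /z Z0 u0 uN.
  - by have [? ? _] := Hz n nM.
  - by have [_ _ /(_ i iN)] := Hz n nM; rewrite /zero addr0.
have zlin (c : R) u u' n i : (n <= M)%N ->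
   z (fun j => c * u j + u' j) n i = c * z u n i + z u' n i.
  move=> nM; rewrite /z -Zlin //.
  by congr (Z _ _ _ _); apply: funext => ?; apply: funext => ?; rewrite /zero mulr0 addr0.
(* The final state reached from zero under the control generated by [u], plus the penalization:
   duality makes its pairing with [u] equal to [tau * J u + phi * mass N u], whence injectivity. *)
pose F u i := Y (ctl u) (fun=> 0) M i + phi * u i.
have Flin (c : R) u u' i : F (fun j => c * u j + u' j) i = c * F u i + F u' i.
  rewrite /F.
  have -> : Y (ctl (fun j => c * u j + u' j)) (fun=> 0) M i =
    c * Y (ctl u) (fun=> 0) M i + Y (ctl u') (fun=> 0) M i.
    rewrite -Ylin //; congr (Y _ _ _ _).
      apply: funext => n; apply: funext => j; rewrite /ctl zlin ?leq_subr //.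
      by case: ifP => _; ring.
    by apply: funext => j; rewrite mulr0 addr0.
  ring.
pose J u := \sum_(n < M) \sum_(i < N | P i.+1) z u n.+1 i.+1 ^+ 2.
have J0 u : 0 <= J u by apply: sumr_ge0 => n _; apply: sumr_ge0 => i _; apply: sqr_ge0.
have JE u : \sum_(n < M) \sum_(i < N) ctl u n i.+1 * z u (M - n)%N i.+1 = tau * J u.
  rewrite /J -(sum_rev M (fun n => \sum_(i < N | P i.+1) z u n i.+1 ^+ 2)) mulr_sumr.
  apply: eq_bigr => n _; rewrite mulr_sumr [RHS]big_mkcond; apply: eq_bigr => i _.
  by rewrite /ctl; case: ifP => _; rewrite ?mulr0 ?mul0r // -mulrA.
have dual u y g' : interior N u -> forward N M h tau a (ctl u) y g' ->
  \sum_(i < N) y M i.+1 * u i.+1 = \sum_(i < N) g' i.+1 * z u M i.+1 + tau * J u.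
  by move=> Iu Hy; rewrite -JE -(duality Hy (zadj u Iu)) /z Z0.
(* The right-hand side cancels the free evolution of [g], so that by linearity the controlled final
   state is [- phi * u]. *)
have [|u [Iu Hu]] := @grid_operator_surj N F Flin _ (fun i => - Y zero g M i).
  move=> u Iu Fu; have := dual u _ _ Iu (YF (ctl u) (fun=> 0)).
  rewrite [X in _ = X + _]big1 ?add0r; last by move=> i _; rewrite mul0r.
  have -> : \sum_(i < N) Y (ctl u) (fun=> 0) M i.+1 * u i.+1 = - (phi * mass N u).
    rewrite /mass mulr_sumr -sumrN; apply: eq_bigr => i _.
    have := Fu i (ltn_ord i); rewrite /F => /eqP; rewrite addr_eq0 => /eqP ->.
    by rewrite expr2 mulNr mulrA.
  move=> E; have : 0 <= tau * J u by rewrite mulr_ge0 // ltW.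
  by rewrite -E oppr_ge0 pmulr_rle0.
have YM y : forward N M h tau a (ctl u) y g -> forall i, (i < N)%N -> y M i.+1 = - (phi * u i.+1).
  move=> Hy i iN.
  have -> : y M i.+1 = Y (ctl u) g M i.+1.
    exact: (forward_unique h0 t0 At Ha Hy (YF _ _)).
  have -> : Y (ctl u) g M i.+1 = Y (ctl u) (fun=> 0) M i.+1 + Y zero g M i.+1.
    have := Ylin 1 (ctl u) zero (fun=> 0) g M i.+1 (leqnn M); rewrite [in RHS]mul1r => <-.
    congr (Y _ _ _ _); last by apply: funext => j; rewrite mulr0 add0r.
    by apply: funext => n; apply: funext => j; rewrite mul1r addr0.
  have := Hu i iN; rewrite /F => E.
  by rewrite -[Y zero g M i.+1]opprK -E; ring.
pose E := tau * J u + phi * mass N u.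
have E0 : 0 <= E by rewrite addr_ge0 // mulr_ge0 ?mass_ge0 // ltW.
have obs : mass N (z u M) <= C * E.
  by have := Hobs (z u) (zadj u Iu); rewrite /z Z0.
have EE : E = - \sum_(i < N) g i.+1 * z u M i.+1.
  have Hy := YF (ctl u) g.
  have := dual u _ _ Iu Hy.
  have -> : \sum_(i < N) Y (ctl u) g M i.+1 * u i.+1 = - (phi * mass N u).
    rewrite /mass mulr_sumr -sumrN; apply: eq_bigr => i _.
    by rewrite (YM _ Hy) // expr2 mulNr mulrA.
  rewrite /E; move: (\sum_(i < N) _) => s; lra.
have EC : E <= C * mass N g.
  (* The weights are chosen so that observability bounds the last term by [C * E], half of the left
     side. *)
  have young : 2 * C * (- \sum_(i < N) g i.+1 * z u M i.+1) <= C ^+ 2 * mass N g + mass N (z u M).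
    rewrite /mass -sumrN !mulr_sumr -big_split /=; apply: ler_sum => i _.
    by have := sqr_ge0 (C * g i.+1 + z u M i.+1); rewrite !expr2; lra.
  rewrite -EE in young.
  rewrite -(ler_pM2l C0); move: young obs; rewrite expr2; lra.
have tJ : 0 <= tau * J u by rewrite mulr_ge0 // ltW.
have pM : 0 <= phi * mass N u by rewrite mulr_ge0 ?mass_ge0 // ltW.
exists (fun n => z u (M - n)%N); split.
- rewrite (sum_rev M (fun n => \sum_(i < N | P i.+1) z u n i.+1 ^+ 2)) -/(J u).
  by apply: le_trans EC; rewrite /E lerDl.
- by exists (Y (ctl u) g); apply: YF.
move=> y Hy.
have -> : mass N (y M) = phi * (phi * mass N u).
  rewrite /mass !mulr_sumr; apply: eq_bigr => i _.
  by rewrite (YM _ Hy) // sqrrN exprMn expr2 mulrA.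
rewrite -[leRHS]mulrA [leRHS]mulrCA ler_pM2l //.
by apply: le_trans EC; rewrite /E lerDr.
Qed.

End Control.

(** * Grid norms, observation window and conclusion *)

Section GridNorms.
Variable R : realType.

Lemma L2sqE N (h : R) u : L2sq N h u = h * mass N u.
Proof. by rewrite /L2sq /mass big_add1 big_mkord mulr_sumr. Qed.

Lemma L2sq_omE (om : set R) N (h : R) u :
  L2sq_om om N h u = h * \sum_(i < N | i.+1%:R * h \in om) u i.+1 ^+ 2.
Proof.
by rewrite /L2sq_om big_add1 (big_mkord (fun i => i.+1%:R * h \in om)) mulr_sumr.
Qed.

Lemma scheme_forward (om : set R) N M (h dt : R) a v y g : 0 < h -> 0 < dt ->
  scheme om N M h dt a v y g <->
  forward N M h dt a (fun n i => dt * (if i%:R * h \in om then v n i else 0)) y g.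
Proof.
move=> h0 t0; have tn : dt != 0 by rewrite gt_eqF.
have eqv n i : (y n.+1 i.+1 - y n i.+1) / dt - lap_h h (y n.+1) i.+1 + a n.+1 i.+1 * y n.+1 i.+1
   = ind_om om h (v n) i.+1 <->
   y n.+1 i.+1 - y n i.+1 =
    dt * ((y n.+1 i.+2 - 2 * y n.+1 i.+1 + y n.+1 i) / h ^+ 2 - a n.+1 i.+1 * y n.+1 i.+1)
    + dt * (if i.+1%:R * h \in om then v n i.+1 else 0).
  rewrite /lap_h /ind_om /=; split=> [<-|->]; field; rewrite ?tn ?gt_eqF //.
split=> [[H0 H]|[H0 H]]; split.
- by move=> i iN; apply: H0.
- move=> n nM; have [a0 [aN E]] := H n nM; split=> // i iN.
  by apply/eqv; apply: E.
- by case=> // i iN; apply: H0.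
move=> n nM; have [a0 aN E] := H n nM; split=> //; split=> //.
by case=> // i iN; apply/eqv; apply: E.
Qed.

Lemma observation_window (om : set R) (L : R) : open om -> om !=set0 ->
  om `<=` `]0, L[ ->
  exists p l : R, [/\ 0 <= p, 0 < l, p + 10 * l <= L &
    forall x, p <= x <= p + 10 * l -> x \in om].
Proof.
move=> oo [x omx] sub.
have [r /= r0 Hr] : nbhs_ball x om by apply/nbhs_ballP; apply: open_nbhs_nbhs.
have W t : x - r / 4 <= t <= x + r / 4 -> om t.
  move=> /andP[t1 t2]; apply: Hr; rewrite /ball /= ltr_norml.
  by apply/andP; split; lra.
(* [10 l = r / 2], so the window is [[x - r/4, x + r/4]]. *)
exists (x - r / 4), (r / 20).
have /sub : om (x - r / 4) by apply: W; apply/andP; split; lra.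
have /sub : om (x + r / 4) by apply: W; apply/andP; split; lra.
rewrite /= !in_itv /= => /andP[? ?] /andP[? ?].
split; try lra.
by move=> t /andP[? ?]; apply: mem_set; apply: W; apply/andP; split; lra.
Qed.

End GridNorms.

Theorem theorem1p2 (R : realType) (L : R) (om : set R) (theta : nat) (T A : R) :
  0 < L ->
  open om -> om !=set0 -> om `<=` `]0, L[ ->
  (1 <= theta <= 4)%N -> 0 < T -> 0 <= A ->
  exists C2 : R, 0 < C2 /\
  forall phi : R -> R,
    (forall h, 0 < h -> 0 < phi h) ->
    (exists c : R, 0 < c /\
       \forall h \near 0^'+,
         c <= phi h / expR (- (C2 / h `^ (theta%:R^-1)))) ->
    exists hstar C : R, 0 < hstar /\ 0 < C /\
    forall (N M : nat), (1 <= N)%N -> (1 <= M)%N ->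
      let h := mesh L N in
      let dt := T / M%:R in
      h <= hstar ->
      dt <= T ^- 2 * h `^ (4 / theta%:R) ->
      forall (a : nat -> nat -> R) (g : nat -> R),
        (forall n i, (1 <= n <= M)%N -> (1 <= i <= N)%N -> `|a n i| <= A) ->
        exists v : nat -> nat -> R,
          Num.sqrt (\sum_(0 <= n < M) dt * L2sq_om om N h (v n))
            <= C * L2 N h g /\
          (exists y : nat -> nat -> R, scheme om N M h dt a v y g) /\
          (forall y : nat -> nat -> R, scheme om N M h dt a v y g ->
             L2 N h (y M) <= C * Num.sqrt (phi h) * L2 N h g).
Proof.
move=> L0 oo om0 omL /andP[th1 th4] T0 A0.
exists (1 / 4); split; first lra.
move=> phi phi0 [c [c0 near_phi]].
have [p [l [p0 l0 pl win]]] := observation_window oo om0 omL.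
have [y0 [C [y00 C0 Hobs]]] := observability L0 T0 A0 p0 l0 pl.
have [e e0 He] : exists2 e : R, 0 < e & forall h, 0 < h -> h < e ->
    c <= phi h / expR (- (1 / 4 / h `^ (theta%:R^-1))).
  move: near_phi => /nbhs_ballP[e /= e0 He]; exists e => // h h0 he.
  by apply: He => //; rewrite /ball /= sub0r normrN gtr0_norm.
have A1 : 0 < 2 * A + 1 by lra.
have T20 : 0 < T ^+ 2 by rewrite exprn_gt0.
pose Y := Num.min y0 (Num.min 1 (T ^+ 2 / (2 * A + 1))).
have Y0 : 0 < Y by rewrite !lt_min y00 ltr01 divr_gt0.
have D0 : 0 < C + C / c by rewrite addr_gt0 // divr_gt0.
(* [h <= Y^theta] means [y <= Y], and [e / 2] gives the strict [h < e]. Under the root, [C] is for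
   the cost of the control and [C / c] for the final state. *)
exists (Num.min (e / 2) (Y ^+ theta)), (Num.sqrt (C + C / c)).
split; first by rewrite lt_min exprn_gt0 // divr_gt0.
split; first by rewrite sqrtr_gt0.
move=> N M N1 M1 h dt; rewrite le_min => /andP[he hY] dth a g Ha.
have N10 : 0 < N.+1%:R :> R by rewrite ltr0n.
have M0 : 0 < M%:R :> R by rewrite ltr0n.
have h0 : 0 < h by rewrite divr_gt0.
have hN : N.+1%:R * h = L by rewrite /h /mesh mulrC divfK // gt_eqF.
have t0 : 0 < dt by rewrite divr_gt0.
have MT : M%:R * dt = T by rewrite /dt mulrC divfK // gt_eqF.
have theta0 : theta%:R != 0 :> R by rewrite pnatr_eq0 -lt0n.
set y := h `^ (theta%:R^-1) in He *.
have yg : 0 < y by rewrite powR_gt0.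
have yth : y ^+ theta = h.
  by rewrite -powR_mulrn ?(ltW yg) // -powRrM mulVf // powRr1 // ltW.
have y4 : h `^ (4 / theta%:R) = y ^+ 4.
  by rewrite -powR_mulrn ?(ltW yg) // -powRrM mulrC.
rewrite y4 in dth.
have yY : y <= Y.
  by rewrite -(@ler_pXn2r _ theta) ?nnegrE ?(ltW yg) ?(ltW Y0) // yth.
have yy0 : y <= y0 by apply: (le_trans yY); rewrite ge_min lexx.
have y1 : y <= 1 by apply: (le_trans yY); rewrite !ge_min lexx orbT.
have yA : y * (2 * A + 1) <= T ^+ 2.
  have : y <= T ^+ 2 / (2 * A + 1) by apply: (le_trans yY); rewrite !ge_min lexx !orbT.
  by rewrite ler_pdivlMr.
have hy : h <= y by rewrite -{1}yth -[leRHS]expr1 ler_wiXn2l // ltW.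
have yh : y ^+ 4 <= h by rewrite -[leRHS]yth ler_wiXn2l // ltW.
have At : 2 * A * dt < 1.
  have y41 : y ^+ 4 <= y by rewrite -[leRHS]expr1 ler_wiXn2l // ltW.
  have X : dt * T ^+ 2 <= y.
    by apply: le_trans y41; rewrite -ler_pdivlMr // mulrC.
  have X2 : dt * T ^+ 2 * (2 * A + 1) <= 1 * T ^+ 2.
    by rewrite mul1r; apply: le_trans yA; rewrite ler_pM2r.
  by rewrite mulrAC ler_pM2r // in X2; clear -X2 t0; lra.
(* Since it dominates the relaxation term of the observability inequality, [phi h / c] can be the
   penalization parameter. *)
have phic : expR (- (1 / 4 / y)) <= phi h / c.
  have := He h h0; rewrite -/y => /(_ _).
  have -> : h < e by clear -he e0; lra.
  move=> /(_ isT); rewrite ler_pdivlMr ?expR_gt0 // => E.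
  by rewrite ler_pdivlMr // mulrC.
have phc0 : 0 < phi h / c by rewrite divr_gt0 // phi0.
have Ha' : forall n i, (n < M)%N -> (i < N)%N -> `|a n.+1 i.+1| <= A.
  by move=> n i nM iN; apply: Ha.
have Hb n i : (n < M)%N -> (i < N)%N -> `|a (M.+1 - n.+1)%N i.+1| <= A.
  by move=> nM iN; apply: Ha => //; rewrite subSS subn_gt0 nM leq_subr.
have obs z : adjoint_scheme N M h dt (fun n => a (M.+1 - n)%N) z ->
    mass N (z M) <= C * (dt * (\sum_(n < M) \sum_(i < N | i.+1%:R * h \in om) z n.+1 i.+1 ^+ 2)
       + phi h / c * mass N (z 0%N)).
  move=> Hz; apply: (le_trans (Hobs N M h dt y _ z M1 h0 hN t0 MT _ hy yh dth Hz Hb)).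
    by rewrite yg yy0.
  rewrite ler_pM2l //; apply: lerD; last by rewrite ler_wpM2r ?mass_ge0.
  rewrite mulr_sumr; apply: ler_sum => n _; rewrite ler_pM2l //.
  rewrite /window_mass [leLHS]big_mkcond [leRHS]big_mkcond /=; apply: ler_sum => i _.
  case: ifP => [/win ->//|_]; case: ifP => // _; exact: sqr_ge0.
have [v [v1 [yf Hyf] v3]] :=
  control_of_observability (P := fun i => i%:R * h \in om) h0 t0 At phc0 C0 Ha' obs g.
have Mg := mass_ge0 N g.
have Cc0 : 0 < C / c by rewrite divr_gt0.
exists v; split.
  rewrite /L2 -sqrtrM ?(ltW D0) // ler_wsqrtr //.
  have -> : \sum_(0 <= n < M) dt * L2sq_om om N h (v n) =
    h * (dt * \sum_(n < M) \sum_(i < N | i.+1%:R * h \in om) v n i.+1 ^+ 2).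
    rewrite big_mkord !mulr_sumr; apply: eq_bigr => n _.
    by rewrite L2sq_omE mulrCA.
  rewrite L2sqE [leRHS]mulrCA ler_pM2l //; apply: (le_trans v1).
  by rewrite ler_wpM2r // lerDl ltW.
split; first by exists yf; apply/scheme_forward.
move=> y' /(scheme_forward _ _ _ _ _ _ _ h0 t0) /v3 Hy'.
rewrite /L2 -sqrtrM ?(ltW D0) // -sqrtrM; last by rewrite mulr_ge0 ?(ltW D0) // ltW // phi0.
rewrite ler_wsqrtr // !L2sqE [leRHS]mulrCA ler_pM2l //; apply: (le_trans Hy').
rewrite ler_wpM2r // mulrA [C * _ / c]mulrAC ler_pM2r ?phi0 //.
by rewrite lerDr ltW.
Qed.
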